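(* Let $m\in\mathbb{N}$. The polynomials $P_\alpha$, $\alpha\in\mathbb{N}^{2m+2}$, $|\alpha|\ge1$, span (by right linear combinations) the space of polynomial solutions of $D\Delta^mP=0$. That is, each $P_\alpha$ satisfies $D\Delta^mP_\alpha=0$ on $S\oplus V$, and every polynomial $P:S\oplus V\to\mathbb{R}_{0,2m+1}$ with $D\Delta^mP=0$ can be written as a finite sum $$P(x)=\sum_{1\le|\alpha|\le d}P_\alpha(x)\,C_\alpha$$ for some $d\in\mathbb{N}$ and some coefficients $C_\alpha\in\mathbb{R}_{0,2m+1}$.
   Context: $\mathbb{R}_{0,2m+1}$ is the Clifford algebra of a real vector space $V$ of dimension $2m+1$ with a negative definite quadratic form; $e_1,\dots,e_{2m+1}$ is an orthonormal basis of $V$ (so $e_i^2=-1$, $e_ie_j=-e_je_i$ for $i\ne j$, $i,j\geq 1$) and $e_0=1$. $S=\mathbb{R}$ is the space of scalars. A point $(x_0,\dots,x_{2m+1})\in\mathbb{R}^{2m+2}$ is identified with $x=\sum_{i=0}^{2m+1}e_ix_i\in S\oplus V\subset\mathbb{R}_{0,2m+1}$. A polynomial $P:S\oplus V\to\mathbb{R}_{0,2m+1}$ is a polynomial in $x_0,\dots,x_{2m+1}$ with coefficients in $\mathbb{R}_{0,2m+1}$. $D=\sum_{i=0}^{2m+1}e_i\frac{\partial}{\partial x_i}$ (acting from the left), $\Delta=\sum_{i=0}^{2m+1}\frac{\partial^2}{\partial x_i^2}$, and $\Delta^m$ is the $m$-times iterated Laplacian. For a multi-index $\alpha\in\mathbb{N}^{2m+2}$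 put $|\alpha|=\sum_{i=0}^{2m+1}\alpha_i$. For $|\alpha|=k\ge1$, $P_\alpha(x)=\sum e_{i_1}x\,e_{i_2}x\cdots e_{i_{k-1}}x\,e_{i_k}$, the sum being over all distinct sequences $(i_1,\dots,i_k)$ in which each index $j\in\{0,\dots,2m+1\}$ occurs exactly $\alpha_j$ times (distinguishable permutations). *)

(* Defs.v *)
From HB Require Import structures.
From mathcomp Require Import all_boot all_order all_algebra.
From mathcomp Require Import reals.
From mathcomp Require Import mpoly.

Set Implicit Arguments.
Unset Strict Implicit.
Unset Printing Implicit Defensive.

Import GRing.Theory.
Local Open Scope ring_scope.

Definition symdiff (T : finType) (A B : {set T}) : {set T} :=
  (A :\: B) :|: (B :\: A).

Section SymDiff.
Context (T : finType).
Implicit Types A B C : {set T}.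

Lemma in_symdiff A B x : (x \in symdiff A B) = (x \in A) (+) (x \in B).
Proof. by rewrite !inE; case: (x \in A); case: (x \in B). Qed.

Lemma symdiffC A B : symdiff A B = symdiff B A.
Proof. by apply/setP => x; rewrite !in_symdiff addbC. Qed.

Lemma symdiffA A B C : symdiff A (symdiff B C) = symdiff (symdiff A B) C.
Proof. by apply/setP => x; rewrite !in_symdiff addbA. Qed.

Lemma symdiff0s A : symdiff set0 A = A.
Proof. by apply/setP => x; rewrite !in_symdiff inE. Qed.

Lemma symdiffss A : symdiff A A = set0.
Proof. by apply/setP => x; rewrite !in_symdiff inE addbb. Qed.

Lemma symdiffK A : involutive (symdiff A).
Proof. by move=> B; rewrite symdiffA symdiffss symdiff0s. Qed.

End SymDiff.

(* The Clifford algebra with n anticommuting generators of square -1; [a A] is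
   the coordinate of a on the basis element e_A, the product of the generators
   indexed by A in increasing order (see [cliff_blade_prod]). *)
Definition clifford (R : comNzRingType) (n : nat) := {ffun {set 'I_n} -> R}.

HB.instance Definition _ (R : comNzRingType) n :=
  GRing.Lmodule.copy (clifford R n) {ffun {set 'I_n} -> R^o}.

(* e_A e_B = cliff_sign A B * e_(A symdiff B): moving e_j, j in B, to the left
   past e_i, i in A, costs a factor -1 if j < i, and contracting costs
   e_i e_i = -1 if i = j. *)
Definition cliff_sign (R : comNzRingType) n (A B : {set 'I_n}) : R :=
  (-1) ^+ #|[set p : 'I_n * 'I_n | [&& p.1 \in A, p.2 \in B & p.2 <= p.1]%N]|.

Definition cliff_blade (R : comNzRingType) n (A : {set 'I_n}) : clifford R n :=
  [ffun B => (B == A)%:R].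

Definition cliff_one (R : comNzRingType) n : clifford R n := cliff_blade R set0.

(* The bilinear extension of the above rule (see [cliff_mul_blade]). *)
Definition cliff_mul (R : comNzRingType) n (a b : clifford R n) :
    clifford R n :=
  [ffun C => \sum_(A : {set 'I_n})
     cliff_sign R A (symdiff A C) * (a A * b (symdiff A C))].

Section CliffordRing.
Context (R : comNzRingType) (n : nat).
Implicit Types (A B C : {set 'I_n}) (a b c : clifford R n).
Local Notation sg := (@cliff_sign R n).

Lemma cliff_signE A B :
  sg A B = \prod_(p : 'I_n * 'I_n)
             (-1) ^+ [&& p.1 \in A, p.2 \in B & p.2 <= p.1]%N.
Proof.
rewrite -expr_sum /cliff_sign -sum1_card; congr (_ ^+ _).
by rewrite big_mkcond /=; apply: eq_bigr => p _; rewrite inE; case: ifP.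
Qed.

Lemma cliff_sign_symdiffl A B C : sg (symdiff A B) C = sg A C * sg B C.
Proof.
rewrite !cliff_signE -big_split; apply: eq_bigr => p _ /=.
rewrite in_symdiff -signr_addb; congr (_ ^+ nat_of_bool _).
by case: (p.1 \in A); case: (p.1 \in B); case: (p.2 \in C); case: (_ <= _)%N.
Qed.

Lemma cliff_sign_symdiffr A B C : sg A (symdiff B C) = sg A B * sg A C.
Proof.
rewrite !cliff_signE -big_split; apply: eq_bigr => p _ /=.
rewrite in_symdiff -signr_addb; congr (_ ^+ nat_of_bool _).
by case: (p.1 \in A); case: (p.2 \in B); case: (p.2 \in C); case: (_ <= _)%N.
Qed.

Lemma cliff_sign0s A : sg set0 A = 1.
Proof. by rewrite cliff_signE big1 // => p _; rewrite inE. Qed.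

Lemma cliff_signs0 A : sg A set0 = 1.
Proof. by rewrite cliff_signE big1 // => p _; rewrite inE andbF. Qed.

Lemma cliff_mulA : associative (@cliff_mul R n).
Proof.
move=> a b c; apply/ffunP => D; rewrite !ffunE.
under eq_bigr => A _ do rewrite ffunE !mulr_sumr.
under [RHS]eq_bigr => E _ do rewrite ffunE mulr_suml mulr_sumr.
rewrite [RHS]exchange_big /=; apply: eq_bigr => A _.
rewrite [RHS](reindex_inj (inv_inj (symdiffK A))) /=.
apply: eq_bigr => B _; rewrite symdiffK.
have -> : symdiff B (symdiff A D) = symdiff (symdiff A B) D.
  by rewrite symdiffA (symdiffC B).
set F := symdiff (symdiff A B) D.
have -> : symdiff A D = symdiff B F.
  by rewrite /F (symdiffC A B) -symdiffA symdiffK.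
rewrite cliff_sign_symdiffr cliff_sign_symdiffl !mulrA.
rewrite -!(mulrC (c F)) !mulrA -!(mulrC (b B)) !mulrA -!(mulrC (a A)) !mulrA.
by rewrite -!mulrA; do 3!congr (_ * _); rewrite [RHS]mulrA [RHS]mulrC !mulrA.
Qed.

Lemma cliff_mul1r : left_id (cliff_one R n) (@cliff_mul R n).
Proof.
move=> a; apply/ffunP => C; rewrite ffunE (bigD1 set0) //= big1 ?addr0.
  by rewrite symdiff0s cliff_sign0s ffunE eqxx !mul1r.
by move=> A /negPf nA; rewrite ffunE nA mul0r mulr0.
Qed.

Lemma cliff_mulr1 : right_id (cliff_one R n) (@cliff_mul R n).
Proof.
move=> a; apply/ffunP => C; rewrite ffunE (bigD1 C) //= big1 ?addr0.
  by rewrite symdiffss cliff_signs0 ffunE eqxx mul1r mulr1.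
move=> A nA; rewrite ffunE; case: eqP => [AC|_]; last by rewrite !mulr0.
case/eqP: nA; apply: (inv_inj (symdiffK A)).
by rewrite AC symdiffss.
Qed.

Lemma cliff_mulDl : left_distributive (@cliff_mul R n) +%R.
Proof.
move=> a b c; apply/ffunP => C; rewrite !ffunE -big_split /=.
by apply: eq_bigr => A _; rewrite ffunE mulrDl mulrDr.
Qed.

Lemma cliff_mulDr : right_distributive (@cliff_mul R n) +%R.
Proof.
move=> a b c; apply/ffunP => C; rewrite !ffunE -big_split /=.
by apply: eq_bigr => A _; rewrite ffunE !mulrDr.
Qed.

Lemma cliff_one_neq0 : cliff_one R n != 0.
Proof.
apply/eqP => /ffunP /(_ set0); rewrite !ffunE eqxx => /eqP.
by rewrite oner_eq0.
Qed.

HB.instance Definition _ := GRing.Zmodule_isNzRing.Build (clifford R n)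
  cliff_mulA cliff_mul1r cliff_mulr1 cliff_mulDl cliff_mulDr cliff_one_neq0.

Lemma cliff_scaleAl (k : R) a b : k *: (a * b) = (k *: a) * b.
Proof.
apply/ffunP => C; rewrite !ffunE scaler_sumr; apply: eq_bigr => A _.
by rewrite !ffunE [LHS]mulrCA; congr (_ * _); exact: mulrA.
Qed.

HB.instance Definition _ :=
  GRing.Lmodule_isLalgebra.Build R (clifford R n) cliff_scaleAl.

Lemma cliff_scaleAr (k : R) a b : k *: (a * b) = a * (k *: b).
Proof.
apply/ffunP => C; rewrite !ffunE scaler_sumr; apply: eq_bigr => A _.
by rewrite !ffunE [LHS]mulrCA; congr (_ * _); exact: mulrCA.
Qed.

HB.instance Definition _ :=
  GRing.Lalgebra_isAlgebra.Build R (clifford R n) cliff_scaleAr.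

Lemma cliff_mul_blade A B :
  cliff_blade R A * cliff_blade R B = sg A B *: cliff_blade R (symdiff A B).
Proof.
apply/ffunP => C; rewrite !ffunE (bigD1 A) //= big1 ?addr0.
  rewrite !ffunE eqxx mul1r; have -> : (symdiff A C == B) = (C == symdiff A B).
    by apply/eqP/eqP => [<-|->]; rewrite symdiffK.
  case: eqP => [->|_]; first by rewrite symdiffK.
  by rewrite [LHS]mulr0 [RHS]mulr0.
by move=> D /negPf nD; rewrite ffunE nD mul0r mulr0.
Qed.

Lemma cliff_sum_blade a : a = \sum_A a A *: cliff_blade R A.
Proof.
apply/ffunP => B; rewrite sum_ffunE (bigD1 B) //= big1 ?addr0.
  by rewrite !ffunE eqxx; exact/esym/mulr1.
by move=> A nA; rewrite !ffunE eq_sym (negPf nA); exact: mulr0.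
Qed.

End CliffordRing.

Definition cliff_gen (R : comNzRingType) n (i : 'I_n) : clifford R n :=
  cliff_blade R [set i].

Section CliffordRelations.
Context (R : comNzRingType) (n : nat).
Implicit Types (i j : 'I_n) (A : {set 'I_n}).

Lemma cliff_sign_set1 i j :
  cliff_sign R [set i] [set j] = (-1) ^+ (j <= i)%N.
Proof.
rewrite cliff_signE (bigD1 (i, j)) //= big1 ?mulr1; first by rewrite !inE !eqxx.
move=> [i' j'] /= nij; rewrite !inE.
by move: nij; rewrite xpair_eqE andbA; case: (_ && _).
Qed.

Lemma cliff_gen_sqr i : cliff_gen R i * cliff_gen R i = -1.
Proof.
by rewrite cliff_mul_blade symdiffss cliff_sign_set1 leqnn scaleN1r.
Qed.

Lemma cliff_gen_anticomm i j :
  i != j -> cliff_gen R i * cliff_gen R j = - (cliff_gen R j * cliff_gen R i).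
Proof.
move=> nij; rewrite !cliff_mul_blade (symdiffC [set j]) !cliff_sign_set1 -scaleNr.
congr (_ *: _); move: nij; rewrite -val_eqE /=.
by case: ltngtP; rewrite //= ?opprK.
Qed.

Lemma cliff_blade_prod A :
  cliff_blade R A = \prod_(i <- enum A) cliff_gen R i.
Proof.
suff H (s : seq 'I_n) : sorted (fun i j : 'I_n => i < j)%N s ->
    cliff_blade R [set:: s] = \prod_(i <- s) cliff_gen R i.
  rewrite -H; first by congr cliff_blade; apply/setP => x; rewrite inE mem_enum.
  rewrite /enum_mem; apply: sorted_filter.
    by move=> x y z; apply: ltn_trans.
  have := iota_ltn_sorted 0 n; rewrite -val_enum_ord sorted_map enumT; exact.
elim: s => [_|i s IHs srt].
  by rewrite big_nil; congr cliff_blade; apply/setP => x; rewrite !inE.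
have srt' : sorted (fun i j : 'I_n => i < j)%N s by exact: path_sorted srt.
have lt_i j : j \in s -> (i < j)%N.
  have tr : transitive (fun i j : 'I_n => i < j)%N.
    by move=> x y z; apply: ltn_trans.
  by move: srt; rewrite /= (path_sortedE tr) => /andP[/allP h _]; exact: h.
rewrite big_cons -(IHs srt') cliff_mul_blade.
have -> : cliff_sign R [set i] [set:: s] = 1.
  rewrite cliff_signE big1 // => p _; rewrite !inE.
  case: eqP => //= ->; case: (boolP (_ \in s)) => //= /lt_i.
  by rewrite ltnNge => /negPf ->.
rewrite scale1r; congr cliff_blade; apply/setP => x.
rewrite in_symdiff !inE; case: eqP => //= ->.
by case: (boolP (i \in s)) => // /lt_i; rewrite ltnn.
Qed.

End CliffordRelations.

(* e_0 = 1, and e_(j+1) is the j-th generator. *)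
Definition e_ (R : comNzRingType) n (i : 'I_n.+1) : clifford R n :=
  if unlift ord0 i is Some j then cliff_gen R j else 1.

(* e_(i_1) x e_(i_2) x ... x e_(i_k); the value at the empty sequence is
   immaterial. *)
Definition xword (A : nzRingType) (I : Type) (e : I -> A) (x : A) (s : seq I) :
    A :=
  if s is i :: s' then foldl (fun w j => w * x * e j) (e i) s' else 0.

(* Polynomials in commuting real variables x_0, ..., x_n with coefficients in
   the Clifford algebra; the variables commute with the coefficients. *)
Notation cpoly R n := {mpoly (clifford R n)[n.+1]}.

Section CliffordAnalysis.
Context (R : comNzRingType) (n : nat).
Implicit Types (P : cpoly R n) (alpha : 'X_{1..n.+1}).

Definition dirac P : cpoly R n := \sum_(i < n.+1) (e_ R i)%:MP * P^`M(i).

Definition laplacian P : cpoly R n := \sum_(i < n.+1) (P^`M(i))^`M(i).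

(* The polynomial x = e_0 x_0 + ... + e_n x_n. *)
Definition paravar : cpoly R n := \sum_(i < n.+1) (e_ R i)%:MP * 'X_i.

Definition Palpha alpha : cpoly R n :=
  \sum_(t : (mdeg alpha).-tuple 'I_n.+1 |
        [forall j, count_mem j t == alpha j])
    xword (fun i => (e_ R i)%:MP) paravar t.

End CliffordAnalysis.

Section Evaluation.
Context (R : comNzRingType) (n : nat).
Implicit Types (P Q : cpoly R n) (alpha : 'X_{1..n.+1}) (v : 'I_n.+1 -> R).

(* The value of P at the point with real coordinates v. *)
Definition cpoly_eval v P : clifford R n := P.@[fun i => (v i)%:A].

Lemma cpoly_evalM v : {morph cpoly_eval v : P Q / P * Q}.
Proof.
have cA (x : clifford R n) (k : R) : GRing.comm x k%:A.
  by rewrite /GRing.comm -scalerAr -scalerAl mulr1 mul1r.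
have [P m m'|h _] := @commr_mmap_is_multiplicative _ _ _
  (fun i => (v i)%:A) idfun (fun i x => cA x (v i)); last exact: h.
by apply: commr_prod => i _; apply: commrX; exact: cA.
Qed.

Lemma cpoly_eval_paravar v :
  cpoly_eval v (paravar R n) = \sum_i v i *: e_ R i.
Proof.
rewrite /cpoly_eval raddf_sum; apply: eq_bigr => i _ /=.
by rewrite -/(cpoly_eval _ _) cpoly_evalM /cpoly_eval mevalC mevalXU mulr_algr.
Qed.

Lemma cpoly_eval_Palpha v alpha :
  cpoly_eval v (Palpha R alpha) =
  \sum_(t : (mdeg alpha).-tuple 'I_n.+1 |
        [forall j, count_mem j t == alpha j])
    xword (@e_ R n) (\sum_i v i *: e_ R i) t.
Proof.
rewrite /cpoly_eval raddf_sum; apply: eq_bigr => t _ /=.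
rewrite -/(cpoly_eval _ _) -cpoly_eval_paravar.
case: (val t) => [|i s] /=; first exact: meval0.
rewrite -[in RHS](mevalC (fun i => (v i)%:A) (e_ R i)) -/(cpoly_eval _ _).
elim: s (e_ R i)%:MP => //= j s IHs w.
by rewrite IHs !cpoly_evalM [cpoly_eval v _%:MP]mevalC.
Qed.

End Evaluation.

(* Main.v *)
(* Write Dbar for the conjugate Dirac operator, s(x) = <a, xbar> for a
   paravector a, and r = |x|^2. As u = ax satisfies u^2 = 2 s u - |a|^2 r, the
   element (ax)^(k-1) a = sum_alpha a^alpha P_alpha is, up to a constant,
   Dbar applied to a Chebyshev polynomial of the first kind in s and r. That
   real polynomial is Phi_k (s^k) with Phi_k = sum_i c_(k,i) r^i Delta^i, so
   comparing the coefficients of a^alpha makes P_alpha a nonzero multiple of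
   Dbar (Phi_k x^alpha). In dimension 2m+2 the image of Phi_k on the homogeneous
   polynomials of degree k >= 1 is exactly the kernel of Delta^(m+1).
   Since D Dbar = Dbar D = Delta, a solution of D Delta^m P = 0 is Dbar G with
   Delta^(m+1) G = 0, hence a combination of the P_alpha. *)
From HB Require Import structures.
Require Import Defs.
From mathcomp Require Import all_boot all_order all_algebra.
From mathcomp Require Import reals.
From mathcomp Require Import mpoly.
From mathcomp Require Import ring lra zify.

Set Implicit Arguments.
Unset Strict Implicit.
Unset Printing Implicit Defensive.

Import Order.TTheory GRing.Theory Num.Theory.
Local Open Scope ring_scope.

(** * The Laplacian and homogeneous polynomials *)

(** The dimension enters through one identity: for p homogeneous of degree k, Delta ([fischer] (M+1)
    p) = (l - m) [fischer] M (Delta p) with l = M + 2 - k. Each Laplacian raises l by one; from l =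
    0 the factor is nonzero for m steps and vanishes at the next. The vanishing puts the image
    inside ker Delta^(m+1); the nonvanishing before it gives surjectivity. In dimension N the
    subtracted number is N/2 - 1, an integer because N = 2m + 2. As Dbar s = a and Dbar r = 2 xbar,
    the Chebyshev claim amounts to matching the two partial derivatives of a first-kind polynomial
    with the second-kind U in a(xa)^K = U_K a - |a|^2 U_(K-1) xbar. The potential is G = D F with
    Delta F = P. It is Clifford-valued, but Dbar commutes with right multiplication by constants, so
    G splits into real coordinates on the e_A, whence the right coefficients. Real polynomials sit
    inside as a central subring, where the calculus is commutative. *)

Definition mlap (S : nzRingType) n (p : {mpoly S[n]}) : {mpoly S[n]} :=
  \sum_(i < n) (p^`M(i))^`M(i).

Lemma mlap_is_linear (S : nzRingType) n : linear (@mlap S n).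
Proof.
move=> c p q; rewrite /mlap scaler_sumr -big_split; apply: eq_bigr => i _ /=.
by rewrite !linearP.
Qed.

HB.instance Definition _ (S : nzRingType) n :=
  GRing.isLinear.Build S {mpoly S[n]} {mpoly S[n]} _ (@mlap S n)
    (@mlap_is_linear S n).

Lemma mlapZ (S : nzRingType) n c (p : {mpoly S[n]}) : mlap (c *: p) = c *: mlap p.
Proof. exact: linearZ. Qed.

Lemma mlap_mulC (S : nzRingType) n (p : {mpoly S[n]}) c :
  mlap (p * c%:MP) = mlap p * c%:MP.
Proof.
rewrite /mlap mulr_suml; apply: eq_bigr => i _.
by rewrite !mderivM mderivC !mulr0 !addr0 mderivM mderivC mulr0 addr0.
Qed.

Lemma mlap_sum (S : nzRingType) n I (r : seq I) (P : pred I)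
    (F : I -> {mpoly S[n]}) :
  mlap (\sum_(i <- r | P i) F i) = \sum_(i <- r | P i) mlap (F i).
Proof. exact: raddf_sum. Qed.

Lemma iter_linear (S : nzRingType) (V : lmodType S) (f : {linear V -> V}) k :
  linear (iter k f).
Proof. by move=> c p q; elim: k => //= k ->; rewrite linearP. Qed.

Section Euler.
Context (R : numFieldType) (n : nat).
Implicit Types (p q : {mpoly R[n]}) (c d : R).

Definition meuler p := \sum_(i < n) 'X_i * p^`M(i).

Lemma meuler_is_linear : linear meuler.
Proof.
move=> c p q; rewrite /meuler scaler_sumr -big_split; apply: eq_bigr => i _ /=.
by rewrite linearP mulrDr -scalerAr.
Qed.

HB.instance Definition _ :=
  GRing.isLinear.Build R {mpoly R[n]} {mpoly R[n]} _ meuler meuler_is_linear.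

Lemma meulerX m : meuler 'X_[m] = (mdeg m)%:R *: 'X_[m].
Proof.
rewrite /meuler mdegE natr_sum scaler_suml; apply: eq_bigr => i _.
rewrite mderivX -scalerAr; have [->|m0] := eqVneq (m i) 0; first by rewrite !scale0r.
by rewrite -mpolyXD addmC submK // lep1mP.
Qed.

Lemma mcoeff_meuler p m : (meuler p)@_m = (mdeg m)%:R * p@_m.
Proof.
rewrite {1}[p]mpolyE (linear_sum (@GRing.Linear.clone _ _ _ _ meuler _)) raddf_sum.
have -> : p@_m = \sum_(k <- msupp p) (p@_k *: 'X_[k])@_m.
  by rewrite {1}[p]mpolyE raddf_sum.
rewrite mulr_sumr.
apply: eq_bigr => k _; rewrite linearZ /= meulerX !mcoeffZ mcoeffX.
by case: eqVneq => [->|_] /=; ring.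
Qed.

Lemma meulerM p q : meuler (p * q) = meuler p * q + p * meuler q.
Proof.
rewrite /meuler mulr_suml mulr_sumr -big_split; apply: eq_bigr => i _ /=.
by rewrite mderivM; ring.
Qed.

Lemma meuler_mderiv p i : meuler p^`M(i) = (meuler p)^`M(i) - p^`M(i).
Proof.
apply/mpolyP => m; rewrite mcoeffB mcoeff_meuler !mcoeff_mderiv mcoeff_meuler.
by rewrite mdegD mdeg1 natrD mulrDl mul1r mulrnDl addrK mulrnAr.
Qed.

(* Homogeneity through Euler's identity; the degree is a scalar so that
   differentiation lowers it without truncation. *)
Definition ehomog c p := meuler p = c *: p.

Lemma ehomog_lin c a p q : ehomog c p -> ehomog c q -> ehomog c (a *: p + q).
Proof.
by rewrite /ehomog linearP /= => -> ->; rewrite scalerDr !scalerA mulrC.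
Qed.

Lemma ehomogZ c a p : ehomog c p -> ehomog c (a *: p).
Proof. by rewrite /ehomog linearZ /= => ->; rewrite !scalerA mulrC. Qed.

Lemma ehomog0 c : ehomog c 0.
Proof. by rewrite /ehomog linear0 scaler0. Qed.

Lemma ehomogD c p q : ehomog c p -> ehomog c q -> ehomog c (p + q).
Proof. by move=> hp hq; rewrite -[p]scale1r; apply: ehomog_lin. Qed.

Lemma ehomog_sum (I : Type) (r : seq I) (P : pred I) (F : I -> {mpoly R[n]}) c :
  (forall i, P i -> ehomog c (F i)) -> ehomog c (\sum_(i <- r | P i) F i).
Proof.
move=> hF; elim/big_rec: _ => [|i p Pi hp]; first exact: ehomog0.
by apply: ehomogD => //; apply: hF.
Qed.

Lemma ehomogM c d p q : ehomog c p -> ehomog d q -> ehomog (c + d) (p * q).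
Proof.
rewrite /ehomog meulerM => -> ->.
by rewrite -scalerAl -scalerAr scalerDl.
Qed.

Lemma ehomogX m : ehomog (mdeg m)%:R 'X_[m].
Proof. exact: meulerX. Qed.

Lemma ehomog_mderiv c p i : ehomog c p -> ehomog (c - 1) p^`M(i).
Proof.
by rewrite /ehomog meuler_mderiv => ->; rewrite linearZ scalerBl scale1r.
Qed.

Lemma ehomog_mlap c p : ehomog c p -> ehomog (c - 2) (mlap p).
Proof.
move=> hp; apply: ehomog_sum => i _.
have -> : c - 2 = c - 1 - 1 by ring.
by do 2!apply: ehomog_mderiv.
Qed.

Lemma ehomog_iter_mlap c p i :
  ehomog c p -> ehomog (c - (2 * i)%:R) (iter i (@mlap R n) p).
Proof.
move=> hp; elim: i => [|i IHi]; first by rewrite muln0 subr0.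
have := ehomog_mlap IHi; rewrite mulnS natrD iterS.
by congr (ehomog _ _); ring.
Qed.

Lemma ehomog_mcoeff c p m : ehomog c p -> p@_m != 0 -> c = (mdeg m)%:R.
Proof.
move=> /(congr1 (mcoeff m)); rewrite mcoeff_meuler mcoeffZ => /esym h nz.
exact: mulIf h.
Qed.

Lemma ehomog_lt0 c p : c < 0 -> ehomog c p -> p = 0.
Proof.
move=> c0 hp; apply/mpolyP => m; rewrite mcoeff0; apply/eqP/negP => /negP nz.
by move: c0; rewrite (ehomog_mcoeff hp nz) ltrn0.
Qed.

(** The scalar degree k - 2i is negative, and only 0 has negative degree. *)
Lemma iter_mlap_eq0 k p i :
  ehomog k%:R p -> (k < 2 * i)%N -> iter i (@mlap R n) p = 0.
Proof.
move=> hp ki; apply: ehomog_lt0 (ehomog_iter_mlap i hp).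
by rewrite subr_lt0 ltr_nat.
Qed.

Lemma mlap_eq0 k p : ehomog k%:R p -> (k < 2)%N -> mlap p = 0.
Proof. by move=> hp k2; apply: (iter_mlap_eq0 (i := 1) hp). Qed.

Lemma ehomog_mlapS k p : ehomog k.+2%:R p -> ehomog k%:R (mlap p).
Proof.
by move=> /ehomog_mlap; rewrite -[k.+2]addn2 natrD addrK.
Qed.

Definition sqnorm : {mpoly R[n]} := \sum_(i < n) 'X_i ^+ 2.

Lemma ehomog_sqnorm : ehomog 2 sqnorm.
Proof.
by apply: ehomog_sum => i _; rewrite mpolyXn; have := ehomogX (U_(i) *+ 2); rewrite mdegMn mdeg1.
Qed.

Lemma ehomog_sqnormX c j p : ehomog c p -> ehomog (c + (2 * j)%:R) (sqnorm ^+ j * p).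
Proof.
move=> hp; elim: j => [|j IHj]; first by rewrite muln0 addr0 expr0 mul1r.
have := ehomogM ehomog_sqnorm IHj; rewrite mulrA -exprS mulnS natrD.
by congr (ehomog _ _); ring.
Qed.

Lemma mderivXU i j : ('X_j : {mpoly R[n]})^`M(i) = (i == j)%:R.
Proof.
rewrite mderivX mnm1E; have [->|ij] := eqVneq j i.
  by rewrite -{1}[U_(i)%MM]add0m addmK scale1r mpolyX0.
by rewrite scale0r.
Qed.

Lemma mderiv_sqnorm i : sqnorm^`M(i) = 2 *: 'X_i.
Proof.
rewrite /sqnorm raddf_sum (bigD1 i) //= big1 ?addr0 => [|j ji].
  by rewrite expr2 mderivM mderivXU eqxx mul1r mulr1 -mulr2n scaler_nat.
by rewrite expr2 mderivM mderivXU eq_sym (negPf ji) mul0r mulr0 addr0.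
Qed.

Lemma mlapM p q :
  mlap (p * q) = mlap p * q + p * mlap q + 2 *: \sum_(i < n) p^`M(i) * q^`M(i).
Proof.
rewrite /mlap mulr_suml mulr_sumr scaler_sumr -!big_split.
apply: eq_bigr => i _ /=.
by rewrite mderivM mderivD !mderivM scaler_nat; ring.
Qed.

Lemma mlap_sqnorm : mlap sqnorm = (2 * n)%:R.
Proof.
rewrite /mlap (eq_bigr (fun=> 2)) => [|i _]; last first.
  by rewrite mderiv_sqnorm linearZ /= mderivXU eqxx scaler_nat.
by rewrite sumr_const card_ord natrM mulr_natr.
Qed.

Lemma mlap_sqnormM c p : ehomog c p ->
  mlap (sqnorm * p) = sqnorm * mlap p + (4 * c + (2 * n)%:R) *: p.
Proof.
move=> hp; rewrite mlapM mlap_sqnorm.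
rewrite (eq_bigr (fun i : 'I_n => 2 *: ('X_i * p^`M(i)))); last first.
  by move=> i _; rewrite mderiv_sqnorm -scalerAl.
rewrite -scaler_sumr -/(meuler p) hp -!mul_mpolyC; ring.
Qed.

(** Iterated sl2 commutator of Delta and r: the constant is the sum of 4(c + 2l) + 2n over l = 0,
    ..., j. *)
Lemma mlap_sqnormXM c j p : ehomog c p ->
  mlap (sqnorm ^+ j.+1 * p) =
    sqnorm ^+ j.+1 * mlap p
    + (j.+1%:R * (4 * (c + j%:R) + (2 * n)%:R)) *: (sqnorm ^+ j * p).
Proof.
move=> hp; elim: j => [|j IHj].
  by rewrite expr1 expr0 mul1r (mlap_sqnormM hp) addr0 mul1r.
rewrite exprS -mulrA (mlap_sqnormM (ehomog_sqnormX j.+1 hp)) IHj.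
rewrite -!mul_mpolyC natrM -[j.+2]addn2 -[j.+1]addn1 !natrD !exprD; ring.
Qed.

End Euler.

(** * The operators Phi = sum_i c_i r^i Delta^i *)

Section Fischer.
Context (R : numFieldType).

Lemma iter_mlapS n i (p : {mpoly R[n]}) :
  iter i (@mlap R n) (mlap p) = iter i.+1 (@mlap R n) p.
Proof. by rewrite -iterSr. Qed.

Lemma iter_mlapZ n i c (p : {mpoly R[n]}) :
  iter i (@mlap R n) (c *: p) = c *: iter i (@mlap R n) p.
Proof. by elim: i => //= i ->; rewrite mlapZ. Qed.

Lemma iter_mlap_mulC (S : nzRingType) n i (p : {mpoly S[n]}) c :
  iter i (@mlap S n) (p * c%:MP) = iter i (@mlap S n) p * c%:MP.
Proof. by elim: i => //= i ->; rewrite mlap_mulC. Qed.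

Lemma iter_mlap_sum (S : nzRingType) n i I (r : seq I) (P : pred I)
    (F : I -> {mpoly S[n]}) :
  iter i (@mlap S n) (\sum_(j <- r | P j) F j) =
  \sum_(j <- r | P j) iter i (@mlap S n) (F j).
Proof. by elim: i => //= i ->; rewrite mlap_sum. Qed.

Lemma iter_mlap0 n i : iter i (@mlap R n) 0 = 0.
Proof. by elim: i => //= i ->; rewrite linear0. Qed.

(* The coefficients of the preimage sum_i b_i r^(i+1) Delta^i H are chosen so
   that its Laplacian telescopes. *)
Lemma mlap_surj n k (H : {mpoly R[n.+1]}) :
  ehomog k%:R H -> exists2 F, ehomog k.+2%:R F & mlap F = H.
Proof.
move=> hH; pose D i := iter i (@mlap R n.+1) H.
pose d i : R := i.+1%:R * (4 * (k%:R - (2 * i)%:R + i%:R) + (2 * n.+1)%:R).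
pose v i : R := \prod_(l < i) (- d l)^-1.
pose u i := v i *: (sqnorm R n.+1 ^+ i * D i).
exists (\sum_(i < k.+1) - v i.+1 *: (sqnorm R n.+1 ^+ i.+1 * D i)).
  apply: ehomog_sum => i _; apply: ehomogZ.
  have := ehomog_sqnormX i.+1 (ehomog_iter_mlap i hH).
  by congr (ehomog _ _); rewrite -[k.+2]addn2 mulnS !natrD; ring.
rewrite raddf_sum (eq_bigr (fun i : 'I_k.+1 => u i - u i.+1)) => [|i _].
  rewrite -(big_mkord xpredT (fun i => u i - u i.+1)).
  under eq_bigr do rewrite -opprB; rewrite sumrN telescope_sumr // opprB.
  rewrite /u /D (iter_mlap_eq0 (i := k.+1) hH) ?mulr0 ?scaler0 ?subr0; last by lia.
  by rewrite /v big_ord0 scale1r mul1r.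
have lapi : mlap (sqnorm R n.+1 ^+ i.+1 * D i) =
    sqnorm R n.+1 ^+ i.+1 * D i.+1 + d i *: (sqnorm R n.+1 ^+ i * D i).
  exact: (mlap_sqnormXM i (ehomog_iter_mlap i hH)).
rewrite [LHS]linearZ /= lapi.
rewrite scalerDr scalerA addrC scaleNr; congr (_ - _).
congr (_ *: _); rewrite {1}/v big_ord_recr /= -/(v i).
rewrite invrN mulrN opprK -mulrA mulVf ?mulr1 //.
(* For i <= k the degree k - 2i of [D i] plus i is the natural number k - i, so [d i] is positive
   and can be inverted. *)
have -> : d i = i.+1%:R * (4 * (k - i)%:R + (2 * n.+1)%:R).
  by rewrite /d natrB ?natrM -1?ltnS //; ring.
by rewrite -!natrM -natrD -natrM pnatr_eq0 muln_eq0; lia.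
Qed.

(* For M = k - 1 these are, up to a factor depending on k only, the coefficients
   of the Chebyshev polynomial T_k, once Delta^i (s^k) is expanded; larger M
   gives the Gegenbauer polynomials of order M - k + 1. *)
Definition fischer_coef M i : R := (- 4^-1) ^+ i * (M - i)`!%:R / i`!%:R.

Definition fischer n M (p : {mpoly R[n]}) : {mpoly R[n]} :=
  \sum_(i < M.+1) fischer_coef M i *: (sqnorm R n ^+ i * iter i (@mlap R n) p).

Lemma fischer_is_linear n M : linear (@fischer n M).
Proof.
move=> c p q; rewrite /fischer scaler_sumr -big_split; apply: eq_bigr => i _ /=.
rewrite iter_linear mulrDr scalerDr -scalerAr !scalerA; congr (_ *: _ + _).
by rewrite mulrC.
Qed.

HB.instance Definition _ n M :=
  GRing.isLinear.Build R {mpoly R[n]} {mpoly R[n]} _ (@fischer n M)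
    (@fischer_is_linear n M).

Lemma ehomog_fischer n M c (p : {mpoly R[n]}) :
  ehomog c p -> ehomog c (fischer M p).
Proof.
move=> hp; apply: ehomog_sum => i _; apply: ehomogZ.
have := ehomog_sqnormX i (ehomog_iter_mlap i hp).
by congr (ehomog _ _); rewrite subrK.
Qed.

Lemma fischer_harmonic n M (p : {mpoly R[n]}) :
  mlap p = 0 -> fischer M p = M`!%:R *: p.
Proof.
move=> hp; rewrite /fischer big_ord_recl big1 ?addr0 => [|i _].
  by rewrite /fischer_coef expr0 subn0 divr1 !mul1r.
by rewrite /= -iterS iterSr hp iter_mlap0 mulr0 scaler0.
Qed.

(** The coefficient of r^i Delta^(i+1) p receives c_(M+1,i) directly and c_(M+1,i+1) times the
    commutator constant; in dimension 2m + 2 these add up to a multiple of c_(M,i) that does not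
    depend on i. *)
Lemma mlap_fischer m M k (p : {mpoly R[(2 * m).+2]}) :
  ehomog k%:R p -> (k < 2 * M.+2)%N ->
  mlap (fischer M.+1 p) =
    (M.+2%:R - k%:R - m%:R) *: fischer M (mlap p).
Proof.
move=> hp kM; pose r := sqnorm R (2 * m).+2.
pose D i := iter i (@mlap R (2 * m).+2) p.
pose d i : R := i.+1%:R * (4 * (k%:R - (2 * i.+1)%:R + i%:R) + (2 * (2 * m).+2)%:R).
have lapt i : mlap (r ^+ i.+1 * D i.+1) = r ^+ i.+1 * D i.+2 + d i *: (r ^+ i * D i.+1).
  exact: (mlap_sqnormXM i (ehomog_iter_mlap i.+1 hp)).
rewrite [fischer _ _]big_ord_recl linearD /= mlapZ mlap_sum mul1r.
under eq_bigr => i _ do rewrite mlapZ lapt scalerDr scalerA.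
rewrite big_split /= addrA.
have -> : fischer_coef M.+1 0 *: mlap p
    + \sum_(i < M.+1) fischer_coef M.+1 (bump 0 i) *: (r ^+ i.+1 * D i.+2)
    = \sum_(i < M.+1) fischer_coef M.+1 i *: (r ^+ i * D i.+1).
  pose G i := fischer_coef M.+1 i *: (r ^+ i * D i.+1).
  transitivity (\sum_(i < M.+2) G i).
    by rewrite [RHS]big_ord_recl; congr (_ + _); rewrite /G /= mul1r.
  (* The top term contains Delta^(M+2) p, zero by the degree bound. *)
  by rewrite big_ord_recr /= /G /D (iter_mlap_eq0 hp kM) mulr0 scaler0 addr0.
rewrite -big_split scaler_sumr; apply: eq_bigr => i _ /=.
rewrite -scalerDl iter_mlapS scalerA; congr (_ *: _).
have le_iM : (i <= M)%N by rewrite -ltnS.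
rewrite /fischer_coef /bump add1n subSS (subSn le_iM) !factS !natrM exprS /d.
have -> : (M - i).+1%:R = M%:R - i%:R + 1 :> R by rewrite -natr1 natrB.
have f0 : i`!%:R != 0 :> R by rewrite pnatr_eq0 -lt0n fact_gt0.
have i0 : 1 + i%:R != 0 :> R by rewrite nat1r pnatr_eq0.
rewrite -[M.+2]addn2 -[(2 * m).+2]addn2 -[i.+1]add1n !natrD natrM.
by field; rewrite f0 i0.
Qed.

(* Raising the Gegenbauer order by one at each Laplacian, the factor in
   [mlap_fischer] vanishes when the order reaches m. *)
Lemma iter_mlap_fischer m k (p : {mpoly R[(2 * m).+2]}) :
  ehomog k.+1%:R p -> iter m.+1 (@mlap R _) (fischer k p) = 0.
Proof.
(* [l] is the Gegenbauer order M - k' + 1, and [j] counts the Laplacians left before the factor l -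
   m vanishes. *)
suff gen j l k' M : forall q : {mpoly R[(2 * m).+2]}, ehomog k'%:R q ->
    (l + j = m)%N -> (M.+1 = l + k')%N -> iter j.+1 (@mlap R _) (fischer M q) = 0.
  by move=> hp; apply: (gen m 0%N k.+1).
elim: j l k' M => [|j IHj] l k' [|M] q hq lj Mk.
- have q0 : mlap q = 0 by apply: (mlap_eq0 hq); lia.
  by rewrite fischer_harmonic //= mlapZ q0 scaler0.
- rewrite /= (mlap_fischer hq); last by lia.
  have -> : M.+2%:R - k'%:R - m%:R = 0 :> R.
    by rewrite Mk -lj addn0 natrD; ring.
  by rewrite scale0r.
- have q0 : mlap q = 0 by apply: (mlap_eq0 hq); lia.
  by rewrite fischer_harmonic // iter_mlapZ iterSr q0 iter_mlap0 scaler0.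
rewrite iterSr (mlap_fischer hq); last by lia.
have [k2|k2] := ltnP k' 2.
  by rewrite (mlap_eq0 hq) // linear0 scaler0 iter_mlap0.
case: k' k2 hq Mk => [|[|k']] // _ hq Mk.
by rewrite iter_mlapZ (IHj l.+1 k') ?scaler0 //; [exact: ehomog_mlapS|lia..].
Qed.

(* By induction on the power of Delta killing H: [mlap_fischer] and the
   surjectivity of Delta produce F with Delta (fischer F) = Delta H, and fischer
   acts as a nonzero scalar on the harmonic remainder. *)
Lemma fischer_surj m k (H : {mpoly R[(2 * m).+2]}) :
  ehomog k.+1%:R H -> iter m.+1 (@mlap R _) H = 0 ->
  exists2 F, ehomog k.+1%:R F & H = fischer k F.
Proof.
suff gen j l k' M : forall q : {mpoly R[(2 * m).+2]}, ehomog k'%:R q ->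
    (l + j = m)%N -> (M.+1 = l + k')%N -> iter j.+1 (@mlap R _) q = 0 ->
    exists2 F, ehomog k'%:R F & q = fischer M F.
  by move=> hH; apply: (gen m 0%N k.+1).
have harm k1 M1 (q : {mpoly R[(2 * m).+2]}) : ehomog k1%:R q -> mlap q = 0 ->
    exists2 F, ehomog k1%:R F & q = fischer M1 F.
  move=> hq q0; exists (M1`!%:R^-1 *: q); first exact: ehomogZ.
  rewrite linearZ /= fischer_harmonic // scalerA mulVf ?scale1r //.
  by rewrite pnatr_eq0 -lt0n fact_gt0.
elim: j l k' M => [|j IHj] l k' M q hq lj Mk qj; first exact: harm.
have [k2|k2] := ltnP k' 2; first by apply: harm => //; apply: mlap_eq0 hq _.
case: k' k2 hq Mk => [|[|k']] // _ hq Mk.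
case: M Mk => [|M] Mk; first by lia.
have [|||F hF eF] := IHj l.+1 k' M (mlap q) (ehomog_mlapS hq); try lia.
  by rewrite iter_mlapS.
have [F' hF' eF'] := mlap_surj hF.
pose c : R := M.+2%:R - k'.+2%:R - m%:R.
have c0 : c != 0.
  have -> : c = - j.+1%:R by rewrite /c Mk -lj !natrD; ring.
  by rewrite oppr_eq0 pnatr_eq0.
have hq' : ehomog k'.+2%:R (fischer M.+1 F') by apply: ehomog_fischer.
have [||G hG eG] := harm k'.+2 M.+1 (- c^-1 *: fischer M.+1 F' + q).
- exact: ehomog_lin.
- rewrite linearP /= (mlap_fischer hF'); last by lia.
  by rewrite eF' -/c -eF scalerA mulNr mulVf // scaleN1r addNr.
exists (c^-1 *: F' + G); first exact: ehomog_lin.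
by rewrite linearP /= -eG scaleNr addrA subrr add0r.
Qed.

End Fischer.

(** * Sums over words and over exponents *)

Lemma big_tupleS (V : nmodType) (I : finType) K (g : seq I -> V) :
  \sum_(t : K.+1.-tuple I) g t = \sum_i \sum_(t : K.-tuple I) g (i :: t).
Proof.
rewrite pair_bigA /= (reindex (fun p : I * K.-tuple I => [tuple of p.1 :: p.2])) //=.
exists (fun t => (thead t, [tuple of behead t])) => [[i t] _|t _].
  by congr (_, _); apply: val_inj.
by rewrite [RHS]tuple_eta.
Qed.

Lemma sum_foldl_tuple (A : nzRingType) (I : finType) (f : I -> A) x K w :
  \sum_(t : K.-tuple I) foldl (fun w j => w * x * f j) w t =
  w * (x * \sum_j f j) ^+ K.
Proof.
elim: K w => [|K IHK] w.
  rewrite (eq_bigr (fun=> w)) => [|t _]; last by rewrite tuple0.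
  by rewrite sumr_const card_tuple expn0 mulr1n mulr1.
rewrite (big_tupleS _ (foldl (fun w j => w * x * f j) w)) /=.
under eq_bigr do rewrite IHK.
by rewrite -mulr_suml exprS mulrA -!mulr_sumr mulrA.
Qed.

Lemma sum_xword_tuple (A : nzRingType) (I : finType) (f : I -> A) x K :
  \sum_(t : K.+1.-tuple I) xword f x t =
  (\sum_j f j) * (x * \sum_j f j) ^+ K.
Proof.
rewrite (big_tupleS _ (xword f x)) /= mulr_suml.
by apply: eq_bigr => i _; rewrite sum_foldl_tuple.
Qed.

Lemma sum_prod_tuple (A : nzRingType) (I : finType) (f : I -> A) K :
  \sum_(t : K.-tuple I) \prod_(j <- t) f j = (\sum_j f j) ^+ K.
Proof.
elim: K => [|K IHK].
  rewrite (eq_bigr (fun=> 1)) => [|t _]; last by rewrite tuple0 big_nil.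
  by rewrite sumr_const card_tuple.
rewrite (big_tupleS _ (fun t => \prod_(j <- t) f j)) exprS -IHK mulr_suml.
apply: eq_bigr => i _; rewrite mulr_sumr.
by apply: eq_bigr => t _; rewrite big_cons.
Qed.

Lemma digits_inj d n (u v : nat -> nat) :
  (forall i, (i < n)%N -> (u i < d)%N /\ (v i < d)%N) ->
  (\sum_(i < n) u i * d ^ i = \sum_(i < n) v i * d ^ i)%N ->
  forall i, (i < n)%N -> u i = v i.
Proof.
elim: n u v => // n IHn u v lt_d.
have d0 : (0 < d)%N by have [] := lt_d 0%N isT; case: d {IHn lt_d}.
have E (w : nat -> nat) : (\sum_(i < n.+1) w i * d ^ i = (\sum_(i < n) w i.+1 * d ^ i) * d + w 0)%N.
  rewrite big_ord_recl expn0 muln1 addnC big_distrl; congr (_ + _)%N.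
  by apply: eq_bigr => i _ /=; rewrite expnSr mulnA.
have [u0 v0] := lt_d 0%N isT.
rewrite !E => e; have e0 : u 0%N = v 0%N.
  by have := congr1 (modn^~ d) e; rewrite !modnMDl !modn_small.
case=> [|i] // lt_in; apply: (IHn (u \o S) (v \o S)) => //= [j jn|].
  exact: lt_d.
by have := congr1 (divn^~ d) e; rewrite !divnMDl // !divn_small // !addn0.
Qed.

Lemma poly_horner_eq0 (R : numFieldType) (p : {poly R}) :
  (forall t, p.[t] = 0) -> p = 0.
Proof.
move=> p0; apply/eqP/negP => /negP nz.
have := @max_poly_roots _ p [seq i%:R | i <- iota 0 (size p)] nz.
rewrite size_map size_iota ltnn => H; apply/notF/H.
  by apply/allP => x _; rewrite rootE p0.
rewrite map_inj_uniq ?iota_uniq //; exact: mulrIn (oner_neq0 R).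
Qed.

(* Kronecker substitution: at a_i = t^(d^i) distinct monomials become distinct
   powers of t. *)
Lemma multinom_sum_eq0 (R : numFieldType) n d (P : pred 'X_{1..n})
    (g : 'X_{1..n} -> R) :
  (forall a : 'I_n -> R,
     \sum_(m : 'X_{1..n < d} | P m) g m * \prod_i a i ^+ m i = 0) ->
  forall m : 'X_{1..n < d}, P m -> g m = 0.
Proof.
move=> g0 m Pm; pose N (k : 'X_{1..n}) := (\sum_(i < n) k i * d ^ i)%N.
(* The degree bound makes every exponent a base-d digit. *)
have N_inj (k l : 'X_{1..n < d}) : N k = N l -> k = l.
  have ltd (b : 'X_{1..n < d}) i : (b i < d)%N.
    by apply: leq_ltn_trans (bmdeg b); rewrite mdegE (bigD1 i) //= leq_addr.
  move=> Nkl; apply/val_inj/mnmP => i.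
  pose w (b : 'X_{1..n}) j := if insub j is Some j' then b j' else 0%N.
  have wE b (j : 'I_n) : w b j = b j by rewrite /w valK.
  rewrite -!wE; apply: (@digits_inj d n) => //.
    by move=> j jn; rewrite -[j]/(nat_of_ord (Ordinal jn)) !wE !ltd.
  by under eq_bigr do rewrite wE; under [RHS]eq_bigr do rewrite wE.
pose p : {poly R} := \sum_(k : 'X_{1..n < d} | P k) g k *: 'X^(N k).
have p0 : p = 0.
  apply: poly_horner_eq0 => t; rewrite -[RHS](g0 (fun i => t ^+ (d ^ i))).
  rewrite /p horner_sum; apply: eq_bigr => k _.
  rewrite hornerZ hornerXn /N expr_sum; congr (_ * _).
  by apply: eq_bigr => i _; rewrite -exprM mulnC.
have := congr1 (coefp (N m)) p0.
rewrite /p raddf_sum (bigD1 m) //= big1 ?addr0 => [|k /andP[_ km]].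
  by rewrite coefZ coefXn eqxx mulr1 coef0.
rewrite coefZ coefXn; case: eqP => [/N_inj/esym ek|_]; last by rewrite mulr0.
by rewrite ek eqxx in km.
Qed.

(** * The conjugate Dirac operator *)

Section ConjugateUnits.
Context (R : comNzRingType) (n : nat).

Definition ebar (i : 'I_n.+1) : clifford R n :=
  if unlift ord0 i is Some j then - cliff_gen R j else 1.

(** The sign of conjugation on the i-th unit; it records that s pairs a with xbar and not with x. *)
Definition esgn (i : 'I_n.+1) : R := if i == ord0 then 1 else -1.

Lemma e_0 : e_ R ord0 = 1 :> clifford R n.
Proof. by rewrite /e_ unlift_none. Qed.

Lemma e_lift j : e_ R (lift ord0 j) = cliff_gen R j :> clifford R n.
Proof. by rewrite /e_ liftK. Qed.

Lemma ebar0 : ebar ord0 = 1.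
Proof. by rewrite /ebar unlift_none. Qed.

Lemma ebar_lift j : ebar (lift ord0 j) = - cliff_gen R j.
Proof. by rewrite /ebar liftK. Qed.

Lemma esgn_ebar i : esgn i *: ebar i = e_ R i.
Proof.
rewrite /esgn; case: (unliftP ord0 i) => [j|] ->.
  by rewrite ebar_lift e_lift scaleN1r opprK.
by rewrite eqxx ebar0 e_0 scale1r.
Qed.

Lemma esgn_sqr i : esgn i * esgn i = 1.
Proof. by rewrite /esgn; case: ifP; rewrite ?mulrNN mulr1. Qed.

Lemma cliff_gen_anti i j :
  cliff_gen R i * cliff_gen R j + cliff_gen R j * cliff_gen R i =
  - (i == j)%:R *+ 2 :> clifford R n.
Proof.
have [->|ij] := eqVneq i j; first by rewrite cliff_gen_sqr mulr2n.
by rewrite (cliff_gen_anticomm R ij) addNr mulr0n oppr0 mul0rn.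
Qed.

Lemma e_ebar_sym i j :
  e_ R i * ebar j + e_ R j * ebar i = (i == j)%:R *+ 2 :> clifford R n.
Proof.
case: (unliftP ord0 i) => [k|] ->; case: (unliftP ord0 j) => [l|] ->;
  rewrite ?e_0 ?e_lift ?ebar0 ?ebar_lift ?mulr1 ?mul1r.
- by rewrite !mulrN -opprD cliff_gen_anti mulNrn opprK (inj_eq lift_inj).
- by rewrite subrr mul0rn.
- by rewrite addNr mul0rn.
by rewrite eqxx mulr2n.
Qed.

Lemma ebar_e_sym i j :
  ebar i * e_ R j + ebar j * e_ R i = (i == j)%:R *+ 2 :> clifford R n.
Proof.
case: (unliftP ord0 i) => [k|] ->; case: (unliftP ord0 j) => [l|] ->;
  rewrite ?e_0 ?e_lift ?ebar0 ?ebar_lift ?mulr1 ?mul1r.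
- by rewrite !mulNr -opprD cliff_gen_anti mulNrn opprK (inj_eq lift_inj).
- by rewrite addNr mul0rn.
- by rewrite subrr mul0rn.
by rewrite eqxx mulr2n.
Qed.

(** Polarised form of ax + xbar abar = 2 s: a paravector product plus its conjugate is a scalar. *)
Lemma e_e_sym i j :
  e_ R i * e_ R j + ebar j * ebar i = (esgn i *+ 2 *+ (i == j))%:A :> clifford R n.
Proof.
rewrite /esgn.
case: (unliftP ord0 i) => [k|] ->; case: (unliftP ord0 j) => [l|] ->;
  rewrite ?e_0 ?e_lift ?ebar0 ?ebar_lift ?mulr1 ?mul1r.
- rewrite mulrNN cliff_gen_anti (inj_eq lift_inj) /=.
  by case: (k == l); rewrite ?mulr0n ?mulr1n ?oppr0 ?mul0rn ?scale0r // -scalerMnl scaleN1r.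
- by rewrite subrr mulr0n scale0r.
- by rewrite subrr mulr0n scale0r.
by rewrite !eqxx mulr1n scaler_nat mulr2n.
Qed.

End ConjugateUnits.

Section Dirac.
Context (R : numFieldType) (n : nat).
Implicit Types (P Q : cpoly R n) (c : clifford R n).
Local Notation eb := (@ebar R n).

(** One operator for both factorizations of Delta: D is the case of [e_], by conversion, and Dbar
    the case of [ebar]. *)
Definition dirac_of (u : 'I_n.+1 -> clifford R n) P : cpoly R n :=
  \sum_(i < n.+1) (u i)%:MP * P^`M(i).

Lemma dirac_of_is_additive u : additive (dirac_of u).
Proof.
move=> P Q; rewrite /dirac_of -sumrB; apply: eq_bigr => i _.
by rewrite mderivB mulrBr.
Qed.

HB.instance Definition _ u := GRing.isZmodMorphism.Build
  (cpoly R n) (cpoly R n) (dirac_of u) (dirac_of_is_additive u).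

Lemma cpoly_mulr2I P Q : P *+ 2 = Q *+ 2 -> P = Q.
Proof.
move=> /(congr1 (fun X => (2^-1 : R)%:A *: X)).
have H X : (2^-1 : R)%:A *: (X *+ 2) = X :> cpoly R n.
  rewrite -scaler_nat scalerA -scalerAl mul1r -scaler_nat scalerA.
  by rewrite mulVf ?pnatr_eq0 // scale1r scale1r.
by rewrite !H.
Qed.

(** Averaging the double sum with its transpose cancels the off-diagonal terms. *)
Lemma sum_sym_collapse (I : finType) (U : I -> I -> clifford R n)
    (f : I -> I -> cpoly R n) :
  (forall i j, U i j + U j i = (i == j)%:R *+ 2) -> (forall i j, f i j = f j i) ->
  \sum_i \sum_j (U i j)%:MP * f i j = \sum_i f i i.
Proof.
move=> hU hf; apply: cpoly_mulr2I; rewrite mulr2n {2}exchange_big -big_split.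
rewrite -sumrMnl; apply: eq_bigr => i _; rewrite -big_split /=.
rewrite (bigD1 i) //= big1 ?addr0 => [|j ji]; rewrite ?(hf j i) -mulrDl -mpolyCD hU.
  by rewrite eqxx mpolyCMn mulrnAl mpolyC1 mul1r.
by rewrite eq_sym (negPf ji) mul0rn mpolyC0 mul0r.
Qed.

Lemma dirac_of_comp u v P :
  (forall i j, u i * v j + u j * v i = (i == j)%:R *+ 2) ->
  dirac_of u (dirac_of v P) = mlap P.
Proof.
move=> huv; have := @sum_sym_collapse _ (fun i j => u i * v j) (fun i j => P^`M(i)^`M(j)) huv.
rewrite [mlap P]/mlap => <- => [|i j]; last exact: mderiv_comm.
apply: eq_bigr => i _; rewrite raddf_sum mulr_sumr; apply: eq_bigr => j _ /=.
by rewrite mderiv_mulC mulrA -mpolyCM mderiv_comm.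
Qed.

Lemma dirac_dbar P : dirac (dirac_of eb P) = mlap P.
Proof. by apply: dirac_of_comp => i j; exact: e_ebar_sym. Qed.

Lemma dbar_dirac P : dirac_of eb (dirac P) = mlap P.
Proof. by apply: dirac_of_comp => i j; exact: ebar_e_sym. Qed.

(** Both sides are Dbar D Dbar P, bracketed differently. *)
Lemma mlap_dbar P : mlap (dirac_of eb P) = dirac_of eb (mlap P).
Proof. by rewrite -(dbar_dirac (dirac_of eb P)) dirac_dbar. Qed.

Lemma dbar_iter_mlap k P :
  iter k (@mlap _ _) (dirac_of eb P) = dirac_of eb (iter k (@mlap _ _) P).
Proof.
elim: k => [//|k IHk].
rewrite iterS [in RHS]iterS IHk; exact: mlap_dbar.
Qed.

(** The operator acts from the left, so constants on the right pass through it; this is why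
    combinations carry their coefficients on the right. *)
Lemma dirac_ofMC u P c : dirac_of u (P * c%:MP) = dirac_of u P * c%:MP.
Proof.
rewrite /dirac_of mulr_suml; apply: eq_bigr => i _.
by rewrite mderivM mderivC mulr0 addr0 mulrA.
Qed.

Definition cemb (p : {mpoly R[n.+1]}) : cpoly R n :=
  map_mpoly (GRing.in_alg (clifford R n)) p.

HB.instance Definition _ := GRing.RMorphism.copy cemb
  (map_mpoly (GRing.in_alg (clifford R n))).

Lemma mcoeff_cemb p m : (cemb p)@_m = (p@_m)%:A.
Proof. exact: mcoeff_map_mpoly. Qed.

Lemma cembZ (c : R) p : cemb (c *: p) = (c%:A : clifford R n) *: cemb p.
Proof. exact: map_mpolyZ. Qed.

Lemma cembD : {morph cemb : p q / p + q}.
Proof. exact: raddfD. Qed.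

Lemma cembC (c : R) : cemb c%:MP = (c%:A : clifford R n)%:MP.
Proof. exact: map_mpolyC. Qed.

Lemma cemb0 : cemb 0 = 0.
Proof. exact: raddf0. Qed.

Lemma cembM : {morph cemb : p q / p * q}.
Proof. exact: rmorphM. Qed.

Lemma cemb_sum I (r : seq I) (P : pred I) F :
  cemb (\sum_(i <- r | P i) F i) = \sum_(i <- r | P i) cemb (F i).
Proof. exact: raddf_sum. Qed.

Lemma cembX m : cemb 'X_[m] = 'X_[m].
Proof. exact: map_mpolyX. Qed.

Lemma cemb_mderiv p i : (cemb p)^`M(i) = cemb p^`M(i).
Proof.
by apply/mpolyP => m; rewrite mcoeff_mderiv !mcoeff_cemb mcoeff_mderiv scalerMnl.
Qed.

Lemma cemb_mlap p : mlap (cemb p) = cemb (mlap p).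
Proof.
rewrite cemb_sum.
by apply: eq_bigr => i _; rewrite !cemb_mderiv.
Qed.

Lemma cemb_iter_mlap k p :
  iter k (@mlap _ _) (cemb p) = cemb (iter k (@mlap _ _) p).
Proof.
elim: k => [//|k IHk].
rewrite iterS [in RHS]iterS IHk; exact: cemb_mlap.
Qed.

Lemma alg_comm (k : R) c : c * k%:A = k%:A * c.
Proof. by rewrite -scalerAr -scalerAl mulr1 mul1r. Qed.

Lemma algC_comm (k : R) P : P * (k%:A : clifford R n)%:MP = (k%:A)%:MP * P.
Proof.
elim/mpolyind: P => [|c m P _ _ IHP]; first by rewrite mul0r mulr0.
rewrite mulrDl IHP mulrDr; congr (_ + _).
rewrite -mul_mpolyC -mulrA -(commr_mpolyX m (_%:MP)) !mulrA -!mpolyCM.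
by rewrite alg_comm.
Qed.

(** Real scalars are central in the Clifford algebra and the variables commute with all
    coefficients. *)
Lemma cemb_comm p Q : Q * cemb p = cemb p * Q.
Proof.
elim/mpolyind: p => [|c m p _ _ IHp]; first by rewrite cemb0 mul0r mulr0.
rewrite cembD mulrDl mulrDr; congr (_ + _); last exact: IHp.
rewrite cembZ cembX -mul_mpolyC mulrA algC_comm -!mulrA.
by rewrite commr_mpolyX.
Qed.

Lemma cemb_mulCA p P Q : cemb p * (P * Q) = P * (cemb p * Q).
Proof. by rewrite mulrA -(cemb_comm p P) mulrA. Qed.

Lemma cpoly_coords P :
  exists p : {set 'I_n} -> {mpoly R[n.+1]},
    P = \sum_A cemb (p A) * (cliff_blade R A)%:MP.
Proof.
elim/mpolyind: P => [|c m P _ _ [p ->]].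
  exists (fun=> 0); rewrite big1 // => A _; by rewrite cemb0 mul0r.
exists (fun A => c A *: 'X_[m] + p A).
rewrite [RHS](eq_bigr (fun A => (c A *: cliff_blade R A) *: 'X_[m] +
  cemb (p A) * (cliff_blade R A)%:MP)) => [|A _]; last first.
  rewrite cembD mulrDl cembZ cembX -!mul_mpolyC -mulrA.
  by rewrite -(commr_mpolyX m (_%:MP)) mulrA -mpolyCM mulr_algl.
by rewrite big_split -scaler_suml -cliff_sum_blade.
Qed.

Lemma cpoly_coords_eq0 (p : {set 'I_n} -> {mpoly R[n.+1]}) :
  \sum_A cemb (p A) * (cliff_blade R A)%:MP = 0 -> forall A, p A = 0.
Proof.
move=> p0 A; apply/mpolyP => m; rewrite mcoeff0.
have := congr1 (fun P : cpoly R n => (P@_m : clifford R n) A) p0.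
rewrite mcoeff0 raddf_sum /=.
have E B : (cemb (p B) * (cliff_blade R B)%:MP)@_m = (p B)@_m *: cliff_blade R B.
  by rewrite -cemb_comm mcoeffCM mcoeff_cemb alg_comm mulr_algl.
under eq_bigr do rewrite E.
rewrite sum_ffunE (bigD1 A) //= big1 ?addr0 => [|B BA].
  by rewrite !ffunE eqxx [_ *: _]mulr1.
by rewrite !ffunE eq_sym (negPf BA) [_ *: _]mulr0.
Qed.

End Dirac.

(** * Powers of a paravector product *)

Section ChebyshevU.
Context (A : comNzRingType) (y z : A).

(** The homogenized Chebyshev polynomial of the second kind, z^(j/2) U_j(y / (2 sqrt z)). For 2i > j
    the binomial vanishes, so the truncated exponent is harmless. *)
Definition chebU j : A :=
  \sum_(i < j.+1) 'C(j - i, i)%:R * ((-1) ^+ i * y ^+ (j - 2 * i) * z ^+ i).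

Lemma chebU0 : chebU 0 = 1.
Proof. by rewrite /chebU big_ord1 !mul1r. Qed.

Lemma chebU1 : chebU 1 = y.
Proof.
by rewrite /chebU big_ord_recr big_ord1 /= bin0 bin0n mul0r addr0 expr1 !mul1r mulr1.
Qed.

Lemma chebU_rec j : chebU j.+2 = y * chebU j.+1 - z * chebU j.
Proof.
rewrite /chebU big_ord_recr /= subnn bin0n mul0r addr0 !mulr_sumr.
rewrite big_ord_recl [X in _ = X - _]big_ord_recl -addrA; congr (_ + _).
  by rewrite /= !bin0 !muln0 !subn0 exprS; ring.
rewrite -sumrN.
rewrite (eq_bigr (fun i : 'I_j.+1 =>
    y * ('C(j - i, i.+1)%:R * ((-1) ^+ i.+1 * y ^+ (j.+1 - 2 * i.+1) * z ^+ i.+1))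
  - z * ('C(j - i, i)%:R * ((-1) ^+ i * y ^+ (j - 2 * i) * z ^+ i)))).
  by rewrite big_split /=; congr (_ + _); apply: eq_bigr.
move=> i _; rewrite /= /bump add1n.
have le_ij : (i <= j)%N by rewrite -ltnS.
rewrite subSS (subSn le_ij) binS natrD mulrDl; congr (_ + _).
  case: (ltnP (j - i) i.+1) => h; first by rewrite bin_small // !mul0r mulr0.
  have -> : (j.+2 - 2 * i.+1 = (j.+1 - 2 * i.+1).+1)%N by lia.
  by move: (j.+1 - 2 * i.+1)%N 'C(_, _)%:R => e b; rewrite !exprS; ring.
have -> : (j.+2 - 2 * i.+1 = j - 2 * i)%N by lia.
by move: (j - 2 * i)%N 'C(_, _)%:R => e b; rewrite !exprS; ring.
Qed.

End ChebyshevU.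

(* The powers of u = Ax stay in the span of 1 and u over the central subring
   because u satisfies a quadratic equation with central coefficients. *)
Lemma sandwich_pow (T : comNzRingType) (S : nzRingType) (f : {rmorphism T -> S})
    (A x xb : S) (y q r : T) k :
  (forall t s, s * f t = f t * s) ->
  A * x * A = f y * A - f q * xb -> x * xb = f r ->
  let U := chebU y (q * r) in
  A * (x * A) ^+ k.+1 = f (U k.+1) * A - f (q * U k) * xb.
Proof.
move=> fC hA hx U; elim: k => [|k IHk].
  by rewrite expr1 mulrA hA /U chebU0 chebU1 mulr1.
have -> : A * (x * A) ^+ k.+2 = A * x * (A * (x * A) ^+ k.+1).
  by rewrite exprS !mulrA.
transitivity (f (U k.+1) * (A * x * A) - f (q * U k) * (A * (x * xb))).
  by rewrite IHk mulrBr [_ * (f _ * _)]mulrA fC -mulrA [A * x * (f _ * _)]mulrA fC !mulrA.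
rewrite hA hx (fC r) mulrBr !mulrA -!rmorphM addrAC -mulrBl -rmorphB.
congr (f _ * _ - f _ * _); last by rewrite mulrC.
by rewrite [RHS]chebU_rec -/(U _) -/(U _); ring.
Qed.

Section Paravectors.
Context (R : numFieldType) (n : nat) (a : 'I_n.+1 -> R).
Local Notation x := (paravar R n).

Definition avec : clifford R n := \sum_i a i *: e_ R i.
Definition avec_bar : clifford R n := \sum_i a i *: ebar R i.
Definition xbar : cpoly R n := \sum_i (ebar R i)%:MP * 'X_i.
Definition linform : {mpoly R[n.+1]} := \sum_i (esgn R i * a i) *: 'X_i.
Definition asq : R := \sum_i a i ^+ 2.

Lemma mulCX (c d : clifford R n) (X Y : cpoly R n) :
  GRing.comm X d%:MP -> (c%:MP * X) * (d%:MP * Y) = (c * d)%:MP * (X * Y).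
Proof.
by move=> h; rewrite -!mulrA [X * (_ * _)]mulrA h mpolyCM !mulrA.
Qed.

Lemma paravar_xbar : x * xbar = cemb (sqnorm R n.+1).
Proof.
transitivity (\sum_i \sum_j (e_ R i * ebar R j : clifford R n)%:MP * ('X_i * 'X_j)).
  rewrite mulr_suml; apply: eq_bigr => i _; rewrite mulr_sumr.
  by apply: eq_bigr => j _; rewrite mulCX //; apply/esym/commr_mpolyX.
rewrite (@sum_sym_collapse _ _ _ (fun i j => e_ R i * ebar R j)
  (fun i j => 'X_i * 'X_j)) => [|i j|i j]; last 2 first.
- exact: e_ebar_sym.
- exact: commr_mpolyX.
rewrite cemb_sum; apply: eq_bigr => i _.
by rewrite !expr2 cembM cembX.
Qed.

Lemma avec_bar_avec : avec_bar * avec = asq%:A.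
Proof.
apply: (can_inj (@mpolyCK n.+1 _)).
transitivity (\sum_i \sum_j (ebar R i * e_ R j : clifford R n)%:MP * ((a i * a j)%:A)%:MP_[n.+1]).
  rewrite mulr_suml raddf_sum; apply: eq_bigr => i _; rewrite mulr_sumr raddf_sum.
  apply: eq_bigr => j _; rewrite -mpolyCM /=; congr (_%:MP).
  by rewrite -scalerAl -!scalerAr mulr1 scalerA.
rewrite (@sum_sym_collapse _ _ _ (fun i j => ebar R i * e_ R j)
  (fun i j => ((a i * a j)%:A)%:MP)) => [|i j|i j]; last 2 first.
- exact: ebar_e_sym.
- by rewrite mulrC.
rewrite -raddf_sum -scaler_suml; congr ((_ *: _)%:MP).
Qed.

Lemma avec_paravar : avec%:MP * x + xbar * avec_bar%:MP = cemb (2 *: linform).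
Proof.
transitivity (\sum_i \sum_j
   (a i *: (e_ R i * e_ R j + ebar R j * ebar R i : clifford R n))%:MP * 'X_j :> cpoly R n).
  rewrite /avec /avec_bar !raddf_sum /= !mulr_suml.
  transitivity (\sum_i \sum_j (a i *: (e_ R i * e_ R j : clifford R n))%:MP * 'X_j
     + \sum_j \sum_i (a i *: (ebar R j * ebar R i : clifford R n))%:MP * 'X_j :> cpoly R n).
    congr (_ + _); apply: eq_bigr => i _; rewrite mulr_sumr; apply: eq_bigr => j _.
      by rewrite mulrA -mpolyCM scalerAl.
    by rewrite -mulrA -(commr_mpolyX _ (_%:MP)) mulrA -mpolyCM scalerAr.
  rewrite [X in _ + X]exchange_big -big_split; apply: eq_bigr => i _.
  rewrite -big_split; apply: eq_bigr => j _ /=.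
  by rewrite -mulrDl -mpolyCD scalerDr.
rewrite /linform scaler_sumr cemb_sum; apply: eq_bigr => i _.
rewrite (bigD1 i) //= big1 ?addr0 => [|j ji].
  rewrite e_e_sym eqxx mulr1n !scalerA cembZ cembX mul_mpolyC.
  by congr ((_ *: _) *: _); rewrite -mulr_natl; ring.
by rewrite e_e_sym eq_sym (negPf ji) mulr0n scale0r scaler0 mpolyC0 mul0r.
Qed.

(** The quadratic equation of u = ax without its last factor x: multiply ax = 2s - xbar abar by a on
    the right and use abar a = |a|^2. *)
Lemma avec_sandwich :
  avec%:MP * x * avec%:MP
  = cemb (2 *: linform) * avec%:MP - cemb asq%:MP * xbar.
Proof.
rewrite -avec_paravar mulrDl -[X in _ + X - _]mulrA -mpolyCM avec_bar_avec.
by rewrite -cembC cemb_comm addrK.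
Qed.

Lemma avec_pow k :
  let U := chebU (2 *: linform) (asq%:MP * sqnorm R n.+1) in
  avec%:MP * (x * avec%:MP) ^+ k.+1 =
  cemb (U k.+1) * avec%:MP - cemb (asq%:MP * U k) * xbar.
Proof.
apply: (@sandwich_pow _ _ (@cemb R n : {rmorphism _ -> _})).
- by move=> t s; exact: cemb_comm.
- exact: avec_sandwich.
exact: paravar_xbar.
Qed.

End Paravectors.

Lemma mderiv_exp (S : comNzRingType) n (p : {mpoly S[n]}) k i :
  (p ^+ k)^`M(i) = p ^+ k.-1 * p^`M(i) *+ k.
Proof.
case: k => [|k] /=; first by rewrite expr0 mulr0n -mpolyC1 mderivC.
elim: k => [|k IHk]; first by rewrite expr1 mul1r.
by rewrite exprS mderivM IHk mulrnAr mulrA -exprS mulrC -mulrS.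
Qed.

(* Stated abstractly: unification unfolds the multiplication of polynomial
   rings when two different coefficient rings occur in one goal. *)
Lemma central_leibniz (I : finType) (T : comNzRingType) (S : nzRingType)
    (F : {rmorphism T -> S}) (u : I -> S) (d : I -> T -> T) f g :
  (forall t s, s * F t = F t * s) ->
  (forall i p q, d i (p * q) = d i p * q + p * d i q) ->
  \sum_i u i * F (d i (f * g)) =
  F f * (\sum_i u i * F (d i g)) + F g * (\sum_i u i * F (d i f)).
Proof.
move=> FC dM; rewrite 2!mulr_sumr -big_split; apply: eq_bigr => i _ /=.
rewrite dM rmorphD !rmorphM mulrDr addrC; congr (_ + _).
  by rewrite mulrA FC.
by rewrite 2!mulrA (FC f).
Qed.

Lemma derivation_exp (T : comNzRingType) (S : nzRingType)
    (F : {rmorphism T -> S}) (D : T -> S) f k :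
  (forall p q, D (p * q) = F p * D q + F q * D p) ->
  D (f ^+ k.+1) = F (f ^+ k *+ k.+1) * D f.
Proof.
move=> DM; elim: k => [|k IHk]; first by rewrite expr1 mulr1n rmorph1 mul1r.
rewrite exprS DM IHk mulrA -rmorphM -mulrDl -rmorphD; congr (F _ * _).
by rewrite mulrnAr -exprS -mulrSr.
Qed.

Section Restrict.
Context (R : numFieldType) (n : nat).
Implicit Types (f g : {mpoly R[n.+1]}).

Definition dbar f : cpoly R n := dirac_of (@ebar R n) (cemb f).

Lemma dbarE f : dbar f = \sum_i (ebar R i)%:MP * cemb f^`M(i).
Proof. by apply: eq_bigr => i _; rewrite cemb_mderiv. Qed.

Lemma dbar_sum I (r : seq I) (P : pred I) (F : I -> {mpoly R[n.+1]}) :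
  dbar (\sum_(i <- r | P i) F i) = \sum_(i <- r | P i) dbar (F i).
Proof. by rewrite /dbar cemb_sum; exact: raddf_sum. Qed.

Lemma dbarM f g : dbar (f * g) = cemb f * dbar g + cemb g * dbar f.
Proof.
rewrite 3!dbarE.
apply: (@central_leibniz 'I_n.+1 {mpoly R[n.+1]} (cpoly R n)
  (@cemb R n : {rmorphism _ -> _}) (fun i => (ebar R i)%:MP)
  (fun i h => h^`M(i)) f g).
- by move=> t s; exact: cemb_comm.
- by move=> i p q; exact: mderivM.
Qed.

Lemma dbarC c : dbar c%:MP = 0.
Proof. by rewrite dbarE big1 // => i _; rewrite mderivC cemb0 mulr0. Qed.

Lemma dbarZ c f : dbar (c *: f) = cemb c%:MP * dbar f.
Proof. by rewrite -mul_mpolyC dbarM dbarC [X in _ + X]mulr0 addr0. Qed.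

Lemma dbar_sqnorm : dbar (sqnorm R n.+1) = cemb 2 * xbar R n.
Proof.
rewrite dbarE mulr_sumr; apply: eq_bigr => i _.
rewrite mderiv_sqnorm scaler_nat -[_ *+ 2]mulr_natl cembM cembX.
exact/esym/cemb_mulCA.
Qed.

Section LinearForm.
Context (a : 'I_n.+1 -> R).
Local Notation s := (linform a).
Local Notation r := (sqnorm R n.+1).
Local Notation q := (asq a).
Local Notation A := ((avec a)%:MP : cpoly R n).

Lemma mderiv_linform i : s^`M(i) = (esgn R i * a i)%:MP.
Proof.
rewrite /linform raddf_sum (bigD1 i) //= big1 ?addr0 => [|j ji].
  by rewrite mderivZ mderivXU eqxx -mul_mpolyC mulr1.
by rewrite mderivZ mderivXU eq_sym (negPf ji) scaler0.
Qed.

Lemma dbar_linform : dbar s = A.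
Proof.
rewrite dbarE /avec raddf_sum; apply: eq_bigr => i _ /=.
rewrite mderiv_linform cembC -mpolyCM; congr (_%:MP).
by rewrite mulr_algr mulrC -scalerA esgn_ebar.
Qed.

(** The gradient of s is constant of squared length |a|^2, the signs squaring to 1; for l < 2 the
    falling factorial is 0. *)
Lemma mlap_linform_exp l : mlap (s ^+ l) = ((l ^_ 2)%:R * q) *: s ^+ (l - 2).
Proof.
rewrite /mlap /asq mulr_sumr scaler_suml; apply: eq_bigr => i _.
rewrite mderiv_exp mderivMn mderivM mderiv_linform mderivC mulr0 addr0.
rewrite mderiv_exp mderiv_linform -mul_mpolyC.
case: l => [|[|l]]; first by rewrite mulr0n ffact_small // mul0r mpolyC0 mul0r.
  by rewrite mulr0n ffact_small // mul0r mul0r mpolyC0 mul0r.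
rewrite ffactSS ffactn1 !subSS subn0 natrM /= -[_ *+ l.+1]mulr_natl.
have <- : (esgn R i * a i) ^+ 2 = a i ^+ 2.
  by rewrite exprMn [esgn R i ^+ 2]expr2 esgn_sqr mul1r.
by rewrite -[_ *+ l.+2]mulr_natl; ring.
Qed.

Lemma iter_mlap_linform_exp i k :
  iter i (@mlap R _) (s ^+ k) = ((k ^_ (2 * i))%:R * q ^+ i) *: s ^+ (k - 2 * i).
Proof.
elim: i => [|i IHi]; first by rewrite muln0 subn0 ffactn0 mulr1 scale1r.
have -> : (2 * i.+1 = (2 * i).+2)%N by rewrite mulnS.
rewrite iterS IHi mlapZ mlap_linform_exp scalerA -subnDA addn2.
congr (_ *: _); rewrite [(_ - _) ^_ 2]ffactnS ffactn1 -subnS !ffactnSr.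
by rewrite !natrM exprS; ring.
Qed.

End LinearForm.
End Restrict.

(** * Matching the coefficients of [fischer] with Chebyshev polynomials *)

Section Coefficients.
Context (R : numFieldType).

Lemma factr_neq0 k : k`!%:R != 0 :> R.
Proof. by rewrite pnatr_eq0 -lt0n fact_gt0. Qed.

Lemma bin_addf e i : 'C(e + i, i)%:R = (e + i)`!%:R / (i`!%:R * e`!%:R) :> R.
Proof.
rewrite -(bin_fact (leq_addl e i)) addnK !natrM.
by field; rewrite !factr_neq0.
Qed.

Lemma ffact_addf e k : ((e + k) ^_ k)%:R = (e + k)`!%:R / e`!%:R :> R.
Proof.
have := ffact_fact (leq_addl e k); rewrite addnK => <-.
by rewrite natrM mulfK ?factr_neq0.
Qed.

Lemma expN4_2 i : (- 4^-1) ^+ i * 2 ^+ (2 * i) = (-1) ^+ i :> R.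
Proof. by rewrite exprM -exprMn; congr (_ ^+ _); field. Qed.

(** Coefficient form of T_k' = k U_(k-1); [e] stands for the exponent K - 2i, which avoids truncated
    subtraction. *)
Lemma fischer_coef_even e i :
  let K := (e + 2 * i)%N in
  2 ^+ K * (fischer_coef R K i * (K.+1 ^_ (2 * i))%:R) * e.+1%:R =
  K.+1`!%:R * ('C(K - i, i)%:R * (-1) ^+ i * 2 ^+ e).
Proof.
move=> K; have Ki : (K - i = e + i)%N by rewrite /K; lia.
rewrite /fischer_coef Ki bin_addf -[K.+1]/((e.+1 + 2 * i)%N) ffact_addf.
rewrite {1}/K exprD -(expN4_2 i) [(e.+1)`!]factS natrM.
by field; rewrite !factr_neq0 nat1r pnatr_eq0.
Qed.

(** The companion for the derivative in r, with i = j + 1; the last factor 2 comes from Dbar r = 2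
    xbar. *)
Lemma fischer_coef_odd e j :
  let K := (e + 2 * j)%N in
  2 ^+ K.+1 * (fischer_coef R K.+1 j.+1 * (K.+2 ^_ (2 * j.+1))%:R) * j.+1%:R * 2 =
  - (K.+2`!%:R * ('C(K - j, j)%:R * (-1) ^+ j * 2 ^+ e)).
Proof.
move=> K; have Kj : (K - j = e + j)%N by rewrite /K; lia.
have K2 : K.+2 = (e + 2 * j.+1)%N by rewrite /K; lia.
rewrite /fischer_coef subSS Kj bin_addf K2 ffact_addf.
rewrite {1}/K exprS exprD -(expN4_2 j) [(j.+1)`!]factS natrM exprS.
by field; rewrite !factr_neq0 nat1r pnatr_eq0.
Qed.

End Coefficients.

(** The product rule for one term of [fischer] applied to a power of s, with r, s, xbar for [f],
    [g], [B]; stated abstractly like [central_leibniz]. *)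
Lemma derivation_monom (T : comNzRingType) (S : nzRingType)
    (F : {rmorphism T -> S}) (D : T -> S) c f g B i l :
  (forall p q, D (p * q) = F p * D q + F q * D p) -> D 1 = 0 ->
  D f = F 2 * B ->
  F c * D (f ^+ i * g ^+ l) =
  F (c * (f ^+ i * (g ^+ l.-1 *+ l))) * D g
  + F (c * (g ^+ l * (f ^+ i.-1 *+ i) * 2)) * B.
Proof.
move=> DM D1 Df; have DX h k : D (h ^+ k) = F (h ^+ k.-1 *+ k) * D h.
  case: k => [|k]; last exact: derivation_exp.
  by rewrite expr0 D1 mulr0n rmorph0 mul0r.
by rewrite DM !DX Df !rmorphM mulrDr !mulrA.
Qed.

Lemma rmorph_sum_mul2 (T S : nzRingType) (F : {rmorphism T -> S}) I (r : seq I)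
    (X Y : I -> T) (A B : S) :
  \sum_(i <- r) (F (X i) * A + F (Y i) * B) =
  F (\sum_(i <- r) X i) * A + F (\sum_(i <- r) Y i) * B.
Proof. by rewrite big_split !rmorph_sum !mulr_suml. Qed.

Lemma rmorph_lin2_eq (T S : nzRingType) (F : {rmorphism T -> S}) c d u v X Y
    (A B : S) :
  d * X = c * u -> d * Y = - (c * v) ->
  F c * (F u * A - F v * B) = F d * (F X * A + F Y * B).
Proof.
move=> eX eY; rewrite mulrBr mulrDr !mulrA -!rmorphM eX eY rmorphN.
by rewrite !rmorphM mulNr.
Qed.

Section MainFormula.
Context (R : numFieldType) (n : nat) (a : 'I_n.+1 -> R).
Local Notation s := (linform a).
Local Notation r := (sqnorm R n.+1).
Local Notation q := (asq a).
Local Notation A := ((avec a)%:MP : cpoly R n).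
Local Notation U := (chebU (2 *: s) (q%:MP * r)).

Let kap K i : R := fischer_coef R K i * (K.+1 ^_ (2 * i))%:R * q ^+ i.

Lemma fischer_linform K :
  fischer K (s ^+ K.+1) =
  \sum_(i < K.+1) (kap K i)%:MP * (r ^+ i * s ^+ (K.+1 - 2 * i)).
Proof.
apply: eq_bigr => i _; rewrite iter_mlap_linform_exp -scalerAr scalerA.
by rewrite mul_mpolyC /kap mulrA.
Qed.

Lemma dbar_fischer_linform K :
  dbar (fischer K (s ^+ K.+1)) =
  cemb (\sum_(i < K.+1) (kap K i)%:MP *
          (r ^+ i * (s ^+ (K.+1 - 2 * i).-1 *+ (K.+1 - 2 * i)))) * A
  + cemb (\sum_(i < K.+1) (kap K i)%:MP *
          (s ^+ (K.+1 - 2 * i) * (r ^+ i.-1 *+ i) * 2)) * xbar R n.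
Proof.
rewrite fischer_linform dbar_sum.
rewrite -(@rmorph_sum_mul2 _ _ (@cemb R n : {rmorphism _ -> _})).
apply: eq_bigr => i _; rewrite mul_mpolyC dbarZ -dbar_linform.
apply: (@derivation_monom _ _ (@cemb R n : {rmorphism _ -> _}) (@dbar R n)).
- exact: dbarM.
- by rewrite -mpolyC1; exact: dbarC.
exact: dbar_sqnorm.
Qed.

Lemma exp2s e : (2 *: s) ^+ e = (2 ^+ e : R) *: s ^+ e.
Proof. exact: exprZn. Qed.

Lemma fischer_chebU K :
  2 ^+ K *: (\sum_(i < K.+1) (kap K i)%:MP *
          (r ^+ i * (s ^+ (K.+1 - 2 * i).-1 *+ (K.+1 - 2 * i))))
  = K.+1`!%:R *: U K.
Proof.
rewrite /chebU 2!scaler_sumr; apply: eq_bigr => i _.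
(* For 2i > K the left side has multiplicity 0 and the right side a zero binomial. *)
have [le|lt] := leqP (2 * i) K; last first.
  have -> : (K.+1 - 2 * i = 0)%N by lia.
  by rewrite bin_small ?mulr0n ?mulr0 ?mul0r ?scaler0 //; lia.
have -> : (K.+1 - 2 * i = (K - 2 * i).+1)%N by lia.
have /= := fischer_coef_even R (K - 2 * i) i; rewrite subnK //.
move: (K - 2 * i)%N => e E.
have -> : 2 ^+ K *: ((kap K i)%:MP * (r ^+ i * (s ^+ e *+ e.+1)))
  = (2 ^+ K * (fischer_coef R K i * (K.+1 ^_ (2 * i))%:R) * e.+1%:R)%:MP
    * (q%:MP ^+ i * r ^+ i * s ^+ e).
  rewrite /kap -!mul_mpolyC -[_ *+ e.+1]mulr_natl.
  move: (fischer_coef _ _ _) (_ ^_ _)%:R (2 ^+ K) => *.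
  rewrite !mpolyCM !mpolyC_nat !rmorphXn /=; ring.
rewrite E exp2s -!mul_mpolyC exprMn.
move: (_ `!)%:R 'C(_, _)%N => *.
rewrite !mpolyCM !mpolyC_nat !rmorphXn /= ?mpolyCN; ring.
Qed.

Lemma fischer_chebU_xbar K :
  2 ^+ K.+1 *: (\sum_(i < K.+2) (kap K.+1 i)%:MP *
          (s ^+ (K.+2 - 2 * i) * (r ^+ i.-1 *+ i) * 2))
  = - (K.+2`!%:R *: (q%:MP * U K)).
Proof.
(* The term i = 0 is free of r; dropping it aligns the rest with [chebU]. *)
rewrite big_ord_recl mulr0n mulr0 mul0r mulr0 add0r.
rewrite /chebU mulr_sumr 2!scaler_sumr -sumrN; apply: eq_bigr => i _.
rewrite lift0 /=.
have [le|lt] := leqP (2 * i) K; last first.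
  rewrite bin_small; last by lia.
  by rewrite /kap ffact_small; [rewrite mulr0 mul0r mpolyC0 !mul0r mulr0 !scaler0 oppr0|lia].
have -> : (K.+2 - 2 * i.+1 = K - 2 * i)%N by lia.
have /= := fischer_coef_odd R (K - 2 * i) i; rewrite subnK //.
move: (K - 2 * i)%N => e E.
have -> : 2 ^+ K.+1 *: ((kap K.+1 i.+1)%:MP * (s ^+ e * (r ^+ i *+ i.+1) * 2))
  = (2 ^+ K.+1 * (fischer_coef R K.+1 i.+1 * (K.+2 ^_ (2 * i.+1))%:R) * i.+1%:R * 2)%:MP
    * (q%:MP ^+ i.+1 * r ^+ i * s ^+ e).
  rewrite /kap -!mul_mpolyC -[_ *+ i.+1]mulr_natl.
  move: (fischer_coef _ _ _) (_ ^_ _)%:R (2 ^+ K.+1) => *.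
  rewrite !mpolyCM !mpolyC_nat !rmorphXn /= !exprS; ring.
rewrite E exp2s -!mul_mpolyC exprMn.
move: (_ `!)%:R 'C(_, _)%N => *.
rewrite mpolyCN !mpolyCM !mpolyC_nat !rmorphXn /= ?mpolyCN exprS; ring.
Qed.

Lemma avec_pow_fischer K :
  cemb (K.+1`!%:R)%:MP * (A * (paravar R n * A) ^+ K) =
  cemb (2 ^+ K)%:MP * dbar (fischer K (s ^+ K.+1)).
Proof.
(* K = 0 is apart: [avec_pow] starts at the first power, where U_(K-1) exists. *)
case: K => [|K].
  have -> : fischer 0 (s ^+ 1) = s.
    rewrite /fischer big_ord1 /fischer_coef /= !mul1r.
    by rewrite invr1 scale1r.
  by rewrite dbar_linform expr0 expr0 mulr1.
rewrite avec_pow dbar_fischer_linform.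
apply: (@rmorph_lin2_eq _ _ (@cemb R n : {rmorphism _ -> _})).
  rewrite [LHS]mul_mpolyC [RHS]mul_mpolyC; exact: fischer_chebU.
rewrite [LHS]mul_mpolyC [X in _ = - X]mul_mpolyC; exact: fischer_chebU_xbar.
Qed.

End MainFormula.

(** * Comparison of coefficients *)

Lemma prod_s2m (T : comNzRingType) n (f : 'I_n -> T) (t : seq 'I_n) :
  \prod_(j <- t) f j = \prod_i f i ^+ (s2m t i).
Proof.
elim: t => [|j t IHt].
  by rewrite big_nil big1 // => i _; rewrite mnmE.
rewrite big_cons IHt [RHS](bigD1 j) //= [in LHS](bigD1 j) //= mulrA -exprS.
congr (_ * _); first by rewrite !mnmE /= eqxx.
by apply: eq_bigr => i ij; rewrite !mnmE /= eq_sym (negPf ij).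
Qed.

Lemma mdeg_s2m n (t : seq 'I_n) : mdeg (s2m t) = size t.
Proof.
elim: t => [|j t IHt]; first by rewrite mdegE big1 // => i _; rewrite mnmE.
rewrite /= -IHt !mdegE (bigD1 j) //= [in RHS](bigD1 j) //= -addSn.
congr (_ + _)%N; first by rewrite !mnmE /= eqxx.
by apply: eq_bigr => i ij; rewrite !mnmE /= eq_sym (negPf ij).
Qed.

Lemma sum_by_content (V : nmodType) n K (g : seq 'I_n -> V) :
  \sum_(t : K.-tuple 'I_n) g t =
  \sum_(m : 'X_{1..n < K.+1} | mdeg m == K)
     \sum_(t : K.-tuple 'I_n | s2m t == m) g t.
Proof.
have ltK (t : K.-tuple 'I_n) : (mdeg (s2m t) < K.+1)%N.
  by rewrite mdeg_s2m size_tuple.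
rewrite (partition_big (fun t => BMultinom (ltK t)) (fun m => mdeg m == K)) /=.
  by apply: eq_bigr => m _; apply: eq_bigl => t; rewrite -val_eqE.
by move=> t _; rewrite mdeg_s2m size_tuple.
Qed.

Lemma xword_central (T : comNzRingType) (S : nzRingType)
    (F : {rmorphism T -> S}) (I : Type) (c : I -> T) (e : I -> S) x t :
  (forall a b, b * F a = F a * b) ->
  xword (fun i => F (c i) * e i) x t = F (\prod_(j <- t) c j) * xword e x t.
Proof.
move=> FC; case: t => [|i t] /=; first by rewrite mulr0.
rewrite big_cons; elim: t (c i) (e i) => [|j t IHt] z w /=.
  by rewrite big_nil mulr1.
rewrite big_cons [z * _]mulrA -IHt; congr foldl.
by rewrite [LHS]mulrA FC (mulrC z) rmorphM !mulrA.
Qed.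

Lemma rmorph_sum_comb (T : comNzRingType) (S : nzRingType)
    (F : {rmorphism T -> S}) I (r : seq I) (P : pred I) (p u : I -> T) c d
    (X Y : I -> S) :
  \sum_(i <- r | P i) F (p i) * (F c * X i - F (d * u i) * Y i) =
  F c * (\sum_(i <- r | P i) F (p i) * X i)
  - F d * (\sum_(i <- r | P i) F (p i * u i) * Y i).
Proof.
rewrite 2!mulr_sumr -sumrB; apply: eq_bigr => i _.
by rewrite mulrBr !mulrA -!rmorphM (mulrC c) mulrCA mulrA.
Qed.

Section PalphaFischer.
Context (R : numFieldType) (n : nat).
Local Notation x := (paravar R n).

Definition rcst (c : R) : cpoly R n := (c%:A : clifford R n)%:MP.

HB.instance Definition _ := GRing.RMorphism.copy rcst
  (@mpolyC n.+1 (clifford R n) \o GRing.in_alg (clifford R n)).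

Lemma rcst1 : rcst 1 = 1.
Proof. exact: rmorph1. Qed.

Lemma rcstM : {morph rcst : c d / c * d}.
Proof. exact: rmorphM. Qed.

(** Frees the word length from [mdeg alpha], so that all exponents of degree K share one type of
    tuples. *)
Lemma PalphaE K alpha : mdeg alpha = K ->
  Palpha R alpha = \sum_(t : K.-tuple 'I_n.+1 | s2m t == alpha)
     xword (fun i => (e_ R i)%:MP) x t.
Proof.
move=> <-; apply: eq_bigl => t; apply/forallP/eqP => [h|/mnmP h j]; last by rewrite -h mnmE.
by apply/mnmP => j; rewrite mnmE; apply/eqP.
Qed.

Lemma avec_pow_Palpha (a : 'I_n.+1 -> R) K :
  (avec a)%:MP * (x * (avec a)%:MP) ^+ K =
  \sum_(alpha : 'X_{1..n.+1 < K.+2} | mdeg alpha == K.+1)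
    rcst (\prod_i a i ^+ alpha i) * Palpha R alpha.
Proof.
have -> : (avec a)%:MP = \sum_i (rcst (a i) * (e_ R i)%:MP) :> cpoly R n.
  rewrite /avec raddf_sum; apply: eq_bigr => i _.
  by rewrite /= -mpolyCM mulr_algl.
rewrite -(sum_xword_tuple (fun i => rcst (a i) * (e_ R i)%:MP)) sum_by_content.
apply: eq_bigr => alpha /eqP deg_a; rewrite (PalphaE deg_a) mulr_sumr.
apply: eq_bigr => t /eqP <-; rewrite -prod_s2m.
apply: (@xword_central _ _ (rcst : {rmorphism _ -> _})) => c s.
exact: algC_comm.
Qed.

(** For alpha of degree K, the multinomial coefficient K!/alpha!. *)
Definition content_card K (alpha : 'X_{1..n.+1}) :=
  #|[pred t : K.-tuple 'I_n.+1 | s2m t == alpha]|.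

Lemma content_card_gt0 alpha : (0 < content_card (mdeg alpha) alpha)%N.
Proof.
by apply/card_gt0P; exists (Tuple (introT eqP (size_m2s alpha))); rewrite inE /= s2mK.
Qed.

Lemma linform_exp (a : 'I_n.+1 -> R) K :
  linform a ^+ K =
  \sum_(alpha : 'X_{1..n.+1 < K.+1} | mdeg alpha == K)
    ((\prod_i a i ^+ alpha i)
      * ((\prod_i esgn R i ^+ alpha i) * (content_card K alpha)%:R)) *: 'X_[alpha].
Proof.
rewrite -sum_prod_tuple (sum_by_content _ (fun t => \prod_(j <- t) _)).
apply: eq_bigr => alpha _.
rewrite (eq_bigr (fun=> ((\prod_i a i ^+ alpha i) * \prod_i esgn R i ^+ alpha i)
   *: 'X_[alpha])) => [|t /eqP <-].
  by rewrite sumr_const -scaler_nat scalerA [in RHS]mulrA mulrC.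
rewrite prod_s2m mpolyXE_id -big_split -scaler_prod; apply: eq_bigr => i _ /=.
by rewrite exprZn exprMn mulrC.
Qed.

Lemma mcoeff_rcst c (P : cpoly R n) b A :
  ((rcst c * P)@_b : clifford R n) A = c * (P@_b : clifford R n) A.
Proof. by rewrite mcoeffCM mulr_algl ffunE. Qed.

(** Both sides of [avec_pow_fischer] are polynomials in a: the left generates the P_alpha, and on
    the right s^(K+1) expands by the multinomial theorem. Their coefficients at a^alpha agree. *)
Lemma Palpha_fischer K alpha : mdeg alpha = K.+1 ->
  rcst K.+1`!%:R * Palpha R alpha =
  rcst (2 ^+ K * ((\prod_i esgn R i ^+ alpha i) * (content_card K.+1 alpha)%:R))
  * dbar (fischer K 'X_[alpha]).
Proof.
move=> deg_a; apply/eqP; rewrite -subr_eq0; apply/eqP.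
pose w (b : 'X_{1..n.+1}) :=
  2 ^+ K * ((\prod_i esgn R i ^+ b i) * (content_card K.+1 b)%:R).
pose f b : cpoly R n := rcst K.+1`!%:R * Palpha R b - rcst (w b) * dbar (fischer K 'X_[b]).
rewrite -/(w alpha) -/(f alpha).
apply/mpolyP => b; rewrite mcoeff0; apply/ffunP => A; rewrite ffunE.
have lt_a : (mdeg alpha < K.+2)%N by rewrite deg_a.
(* Fixing a monomial [b] and a blade [A] makes the coefficients real. *)
apply: (@multinom_sum_eq0 R n.+1 K.+2 (fun b => mdeg b == K.+1)
  (fun c => ((f c)@_b : clifford R n) A) _ (BMultinom lt_a)); last by rewrite /= deg_a.
move=> a.
pose coord (P : cpoly R n) : R := (P@_b : clifford R n) A.
have coordD : {morph coord : P Q / P + Q}.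
  by move=> P Q; rewrite /coord mcoeffD ffunE.
have coord0 : coord 0 = 0 by rewrite /coord mcoeff0 ffunE.
suff E : \sum_(c : 'X_{1..n.+1 < K.+2} | mdeg c == K.+1)
    rcst (\prod_i a i ^+ c i) * f c = 0.
  have := congr1 coord E; rewrite coord0 (big_morph coord coordD coord0) => E0.
  rewrite -[RHS]E0; apply: eq_bigr => c _.
  by rewrite [in RHS]/coord mcoeff_rcst mulrC.
rewrite (@rmorph_sum_comb _ _ (rcst : {rmorphism _ -> _})).
rewrite -avec_pow_Palpha; apply/eqP; rewrite subr_eq0; apply/eqP.
have := avec_pow_fischer a K; rewrite !cembC => ->; congr (_ * _).
rewrite linform_exp (linear_sum (@fischer R n.+1 K : {linear _ -> _})) dbar_sum.
by apply: eq_bigr => c _; rewrite linearZ /= dbarZ cembC.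
Qed.

End PalphaFischer.

(** * Spanning *)

Section Homogeneous.
Context (R : numFieldType) (n : nat).
Implicit Types p : {mpoly R[n.+1]}.

Definition hcomp d k p : {mpoly R[n.+1]} :=
  \sum_(m : 'X_{1..n.+1 < d} | mdeg m == k) p@_m *: 'X_[m].

Lemma ehomog_hcomp d k p : ehomog k%:R (hcomp d k p).
Proof.
apply: ehomog_sum => m /eqP <-; apply: ehomogZ; exact: ehomogX.
Qed.

Lemma sum_hcomp d p : (msize p <= d)%N -> p = \sum_(k < d) hcomp d k p.
Proof.
move=> pd; rewrite {1}(mpolywE pd).
by rewrite (partition_big (fun m : 'X_{1..n.+1 < d} => Ordinal (bmdeg m)) xpredT).
Qed.

Lemma hcomp_id d k p : (k < d)%N -> ehomog k%:R p -> hcomp d k p = p.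
Proof.
move=> kd hp; apply/mpolyP => b; rewrite raddf_sum /=.
have [/eqP bk|bk] := boolP (mdeg b == k); last first.
  rewrite big1 => [|m /eqP mk].
    apply/esym/eqP; apply: contraNT bk => /(ehomog_mcoeff hp)/eqP.
    by rewrite eqr_nat eq_sym.
  rewrite mcoeffZ mcoeffX; case: eqP => [e|_]; last by rewrite mulr0.
  by rewrite -e mk eqxx in bk.
have bd : (mdeg b < d)%N by rewrite bk.
rewrite (bigD1 (BMultinom bd)) /= ?bk // mcoeffZ mcoeffX eqxx mulr1.
rewrite big1 ?addr0 // => m /andP[_ mb]; rewrite mcoeffZ mcoeffX.
case: eqP => [e|_]; last by rewrite mulr0.
by case/eqP: mb; apply: val_inj.
Qed.

(** Pieces of different degrees share no monomial. The offset [c] covers iterated Laplacians, whose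
    degrees k - 2(m+1) may be negative. *)
Lemma sum_ehomog_eq0 d c (G : nat -> {mpoly R[n.+1]}) :
  (forall k, ehomog (k%:R - c) (G k)) -> \sum_(k < d) G k = 0 ->
  forall k, (k < d)%N -> G k = 0.
Proof.
move=> hG G0 k kd; apply/mpolyP => b; rewrite mcoeff0; apply/eqP/negP => /negP nz.
have := congr1 (mcoeff b) G0; rewrite mcoeff0 raddf_sum /= (bigD1 (Ordinal kd)) //=.
rewrite big1 ?addr0 => [/eqP|l lk]; first by rewrite (negPf nz).
apply/eqP; apply: contraNT lk => /(ehomog_mcoeff (hG l)) e.
have e' := ehomog_mcoeff (hG k) nz.
have : (l : nat)%:R = k%:R :> R by rewrite -[LHS](subrK c) e -e' subrK.
by move/eqP; rewrite eqr_nat -val_eqE.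
Qed.

Lemma mlap_onto p : exists f, mlap f = p.
Proof.
elim/mpolyind: p => [|c m p _ _ [f <-]]; first by exists 0; rewrite linear0.
have [g _ eg] := mlap_surj (ehomogX R m).
by exists (c *: g + f); rewrite linearP /= eg.
Qed.

Lemma dbar_hom0 p : ehomog 0 p -> dbar p = 0.
Proof.
move=> hp; rewrite dbarE big1 // => i _.
rewrite (_ : p^`M(i) = 0) ?cemb0 ?mulr0 //.
by apply: ehomog_lt0 (ehomog_mderiv i hp); rewrite sub0r oppr_lt0 ltr01.
Qed.

End Homogeneous.

Section Span.
Context (R : numFieldType).

Lemma Palpha_dbar n K alpha : mdeg alpha = K.+1 ->
  exists c, Palpha R alpha = dbar (fischer K (c *: 'X_[alpha])) :> cpoly R n.
Proof.
move=> deg_a; have := Palpha_fischer R deg_a; set w := 2 ^+ K * _ => e.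
exists (K.+1`!%:R^-1 * w).
rewrite linearZ /= dbarZ cembC -/(rcst n (_ * w)) rcstM -mulrA -e mulrA -rcstM.
by rewrite mulVf ?factr_neq0 // rcst1 mul1r.
Qed.

(** The converse direction divides by [w], a product of a power of 2, signs and a positive
    multinomial coefficient. *)
Lemma dbar_Palpha n K alpha : mdeg alpha = K.+1 ->
  exists c, dbar (fischer K 'X_[alpha]) = Palpha R alpha * rcst n c.
Proof.
move=> deg_a; have := Palpha_fischer R deg_a; set w := 2 ^+ K * _ => e.
have w0 : w != 0.
  rewrite mulf_neq0 ?expf_neq0 ?pnatr_eq0 // mulf_neq0 //.
    apply/prodf_neq0 => i _; rewrite expf_neq0 //.
    by apply/negP => /eqP h; have := esgn_sqr R i; rewrite h mul0r => /esym/eqP; rewrite oner_eq0.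
  by rewrite pnatr_eq0 -lt0n -deg_a content_card_gt0.
exists (w^-1 * K.+1`!%:R).
rewrite [RHS]algC_comm -/(rcst n _) rcstM -mulrA e mulrA -rcstM.
by rewrite mulVf // rcst1 mul1r.
Qed.

Lemma dbar_span m d k (H : {mpoly R[(2 * m).+2]}) :
  (k < d)%N -> ehomog k%:R H -> iter m.+1 (@mlap R _) H = 0 ->
  exists c : 'X_{1..(2 * m).+2} -> R,
    dbar H = \sum_(alpha : 'X_{1..(2 * m).+2 < d} | (1 <= mdeg alpha)%N && (mdeg alpha == k))
      Palpha R alpha * rcst (2 * m).+1 (c alpha).
Proof.
case: k => [|K] kd hH H0.
  (* In degree 0, Dbar kills the constants and the index set is empty. *)
  exists (fun=> 0); rewrite dbar_hom0 // big1 // => b /andP[+ /eqP e].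
  by rewrite e.
have [F hF ->] := fischer_surj hH H0.
have H1 (b : 'X_{1..(2 * m).+2 < d}) : exists c : R, mdeg b = K.+1 ->
    dbar (fischer K 'X_[b]) = Palpha R b * rcst (2 * m).+1 c.
  have [e|ne] := eqVneq (mdeg b) K.+1; last by exists 0 => e; rewrite e eqxx in ne.
  by have [c ec] := dbar_Palpha e; exists c.
have [c Hc] := fin_all_exists H1.
exists (fun b => if insub b is Some b' then F@_b * c b' else 0).
rewrite -{1}(hcomp_id kd hF) (linear_sum (@fischer R _ K : {linear _ -> _})) dbar_sum.
apply: eq_big => [b|b /eqP e].
  by case: eqP => [->|_]; rewrite ?andbT ?andbF.
rewrite valK linearZ /= dbarZ cembC Hc // -/(rcst _ _) [_ * c b]mulrC rcstM [RHS]mulrA.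
exact/esym/algC_comm.
Qed.

Lemma dbar_span_all m d (g : {mpoly R[(2 * m).+2]}) :
  (msize g <= d)%N -> iter m.+1 (@mlap R _) g = 0 ->
  exists c : 'X_{1..(2 * m).+2} -> R,
    dbar g = \sum_(alpha : 'X_{1..(2 * m).+2 < d} | (1 <= mdeg alpha)%N)
      Palpha R alpha * rcst (2 * m).+1 (c alpha).
Proof.
move=> gd g0.
have killed k : (k < d)%N -> iter m.+1 (@mlap R _) (hcomp d k g) = 0.
  apply: (@sum_ehomog_eq0 _ _ d (2 * m.+1)%:R
    (fun k => iter m.+1 (@mlap R _) (hcomp d k g))).
    by move=> l; apply: ehomog_iter_mlap; exact: ehomog_hcomp.
  by rewrite -[RHS]g0 {2}(sum_hcomp gd) iter_mlap_sum.
have [c Hc] := fin_all_exists (fun k : 'I_d =>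
  dbar_span (ltn_ord k) (ehomog_hcomp d k g) (killed k (ltn_ord k))).
(* Each exponent takes its coefficient from the component of its own degree. *)
exists (fun b => if insub (mdeg b) is Some k then c k b else 0).
rewrite (sum_hcomp gd) dbar_sum.
rewrite (partition_big (fun b : 'X_{1..(2 * m).+2 < d} => Ordinal (bmdeg b)) xpredT) //=.
apply: eq_bigr => k _; rewrite Hc; apply: eq_big => [b|b /andP[_ /eqP e]].
  by rewrite -val_eqE.
by rewrite e valK.
Qed.

End Span.

Theorem mainTheorem4 (R : realType) (m : nat) :
  (forall alpha : 'X_{1..(2 * m).+2}, (1 <= mdeg alpha)%N ->
     dirac (iter m (@laplacian R (2 * m).+1) (Palpha R alpha)) = 0) /\
  (forall P : cpoly R (2 * m).+1,
     dirac (iter m (@laplacian R (2 * m).+1) P) = 0 ->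
     exists (d : nat) (C : 'X_{1..(2 * m).+2} -> clifford R (2 * m).+1),
       P = \sum_(alpha : 'X_{1..(2 * m).+2 < d.+1} | (1 <= mdeg alpha)%N)
             Palpha R alpha * (C alpha)%:MP).
Proof.
(* D Delta^m Dbar = D Dbar Delta^m = Delta^(m+1). *)
have DL (Q : cpoly R (2 * m).+1) :
    dirac (iter m (@laplacian R (2 * m).+1) (dirac_of (@ebar R _) Q)) =
    iter m.+1 (@mlap _ _) Q.
  by rewrite -[LHS]/(dirac (iter m (@mlap _ _) _)) dbar_iter_mlap dirac_dbar iterS.
split=> [alpha|P].
  case Ek: (mdeg alpha) => [|K] // _.
  have [c ->] := Palpha_dbar R Ek.
  rewrite DL cemb_iter_mlap iter_mlap_fischer ?cemb0 //.
  by rewrite -Ek; apply: ehomogZ; exact: ehomogX.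
have [p ->] := cpoly_coords P.
have [f Hf] := fin_all_exists (fun A => mlap_onto (p A)).
pose F := \sum_A cemb (f A) * (cliff_blade R A)%:MP.
(* With Delta F = P, P = Dbar (D F). *)
have -> : \sum_A cemb (p A) * (cliff_blade R A)%:MP = dirac_of (@ebar R _) (dirac F).
  rewrite dbar_dirac mlap_sum; apply: eq_bigr => A _.
  by rewrite mlap_mulC cemb_mlap Hf.
rewrite DL; have [g ->] := cpoly_coords (dirac F); rewrite iter_mlap_sum.
under eq_bigr do rewrite iter_mlap_mulC cemb_iter_mlap.
(* The equation on P now says that Delta^(m+1) kills each real coordinate of D F. *)
move=> /cpoly_coords_eq0 g0.
pose d := \max_A msize (g A).
have gd A : (msize (g A) <= d.+1)%N by apply: leqW; exact: leq_bigmax.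
have [c Hc] := fin_all_exists (fun A => dbar_span_all (gd A) (g0 A)).
(* C_alpha collects, blade by blade, the real coefficients found for the coordinates of D F. *)
exists d, (fun b => \sum_A c A b *: cliff_blade R A).
rewrite raddf_sum /=.
under eq_bigr => A _ do rewrite dirac_ofMC -/(dbar _) Hc mulr_suml.
rewrite exchange_big; apply: eq_bigr => b _.
rewrite raddf_sum mulr_sumr; apply: eq_bigr => A _ /=.
by rewrite -mulrA -mpolyCM mulr_algl.
Qed.
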